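(* A (non-directed) graph $G$ has a planar drawing if and only if there exists an orientation on $G$ and an upward planar order on $E(G)$ with respect to the orientation.
   Context: Graphs are finite. An orientation on $G$ is a choice of direction for each edge, making $G$ a directed graph. For a directed graph and a vertex $v$, $I(v)$ and $O(v)$ are the sets of incoming and outgoing edges of $v$, and $E(v)=I(v)\cup O(v)$. For edges $e_1\ne e_2$, $e_1\rightarrow e_2$ means there is a directed path starting from $e_1$ and ending with $e_2$. For a finite set with a linear order $\prec$ and a nonempty subset $X$, $X^-=\min X$, $X^+=\max X$, $\overline{X}=\{y: X^-\preceq y\preceq X^+\}$; $\overline{\emptyset}=\emptyset$. An upward planar order on a directed graph $G$ is a linear order $\prec$ on its edge set $E(G)$ such that: $(U_1)$ $e_1\rightarrow e_2$ implies $e_1\prec e_2$; $(U_2)$ for any vertex $v$, $\overline{I(v)}\cap\overline{O(v)}=\emptyset$ and $\overline{E(v)}=\overline{I(v)}\sqcup\overline{O(v)}$; $(U_3)$ for any two vertices $v_1,v_2$, $I(v_1)\cap\overline{I(v_2)}\neq\emptyset$ implies $\overline{I(v_1)}\subseteq\overline{I(v_2)}$, and $O(v_1)\cap\overline{O(v_2)}\neq\emptyset$ implies $\overline{O(v_1)}\subseteq\overline{O(v_2)}$. *)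

(* Defs.v *)
From mathcomp Require Import all_boot all_order all_algebra.
From mathcomp Require Import all_classical all_reals all_analysis.
Import Order.TTheory GRing.Theory Num.Theory numFieldNormedType.Exports.

Set Implicit Arguments.
Unset Strict Implicit.
Unset Printing Implicit Defensive.

Local Open Scope ring_scope.
Local Open Scope classical_set_scope.

(* Parallel edges are allowed, loops are not: a loop e at v would lie in both
   in_edges v and out_edges v whatever its direction, so no graph with a loop
   has an upward planar order, although it may be planar. *)
Record graph := Graph {
  vertex : finType;
  edge : finType;
  ends : edge -> {set vertex};
  card_ends : forall e, #|ends e| = 2%N }.

Record digraph := Digraph {
  dvertex : finType;
  dedge : finType;
  source : dedge -> dvertex;
  target : dedge -> dvertex }.

Record orientation (G : graph) := Orientation {
  tail_of : edge G -> vertex G;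
  head_of : edge G -> vertex G;
  tail_head_of : forall e, ends e = [set tail_of e; head_of e]%SET }.

Definition orient (G : graph) (o : orientation G) : digraph :=
  Digraph (tail_of o) (head_of o).

Section UpwardPlanarOrder.
Variable D : digraph.

Definition in_edges (v : dvertex D) : {set dedge D} :=
  [set e | target e == v]%SET.
Definition out_edges (v : dvertex D) : {set dedge D} :=
  [set e | source e == v]%SET.
Definition inc_edges (v : dvertex D) : {set dedge D} :=
  (in_edges v :|: out_edges v)%SET.

Definition reaches (e1 e2 : dedge D) : bool :=
  (e1 != e2) && connect (fun e f => target e == source f) e1 e2.

End UpwardPlanarOrder.

Section LinearOrder.
Variables (T : finType) (le : rel T).

Definition linear_order : Prop :=
  [/\ reflexive le, antisymmetric le, transitive le & total le].

Definition is_min (X : {set T}) (m : T) : bool :=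
  (m \in X) && [forall x in X, le m x].
Definition is_max (X : {set T}) (m : T) : bool :=
  (m \in X) && [forall x in X, le x m].

(* The interval from min X to max X; it is empty when X is. *)
Definition hull (X : {set T}) : {set T} :=
  [set y | [exists a, exists b,
    [&& is_min X a, is_max X b, le a y & le y b]]]%SET.

End LinearOrder.

(* le is the reflexive closure of the strict order on edges. *)
Definition upward_planar_order (D : digraph) (le : rel (dedge D)) : Prop :=
  let I := @in_edges D in
  let O := @out_edges D in
  let E := @inc_edges D in
  [/\ linear_order le,
      forall e1 e2, reaches e1 e2 -> (e1 != e2) && le e1 e2,
      forall v, (hull le (I v) :&: hull le (O v))%SET = finset.set0 /\
                hull le (E v) = (hull le (I v) :|: hull le (O v))%SET &
      forall v1 v2,
        ((I v1 :&: hull le (I v2))%SET != finset.set0 ->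
           hull le (I v1) \subset hull le (I v2)) /\
        ((O v1 :&: hull le (O v2))%SET != finset.set0 ->
           hull le (O v1) \subset hull le (O v2))].

(* Edges are drawn as simple arcs parametrized by [0, 1] in an arbitrary
   direction; the values of arc e outside [0, 1] are irrelevant. *)
Record planar_drawing (R : realType) (G : graph) := PlanarDrawing {
  pos : vertex G -> R * R;
  arc : edge G -> R -> R * R;
  pos_inj : injective pos;
  arc_continuous : forall e, {within `[0, 1]%classic, continuous (arc e)};
  arc_inj : forall e, {in `[0, 1]%R &, injective (arc e)};
  arc_ends : forall e, exists u v,
    [/\ ends e = [set u; v]%SET, arc e 0 = pos u & arc e 1 = pos v];
  arc_avoids_vertices : forall e v (t : R), t \in `]0, 1[%R -> arc e t <> pos v;
  arc_disjoint : forall e f (s t : R), e != f ->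
    s \in `]0, 1[%R -> t \in `]0, 1[%R -> arc e s <> arc f t }.

(* Main.v *)
(* From an order to a drawing.  The head classes and the tail classes of an upward
   planar order are noncrossing partitions of the edge set.  Put the edges on a
   line, draw the head classes above it and the tail classes below it; when a
   vertex has edges of both kinds, its last incoming edge and its first outgoing
   edge are consecutive, so the vertex fits on the line between them.

   From a drawing to an order.  By compactness the drawing exhibits G as a minor
   of a square lattice, so every edge set of G inherits an algebraic dual: faces
   left and right of each edge such that flows are exactly the differences of
   face potentials.  When no vertex separates the edge set, it has an acyclic
   orientation with one source s, one sink t and an edge e0 = st; then any two
   edges are joined by a directed path either in the graph or in the dual cut
   open at e0, never both, and "below or left of" is an upward planar order
   starting with e0.  Orders of the pieces are glued at separating vertices. *)
Require Import Defs.
From mathcomp Require Import all_boot all_order all_algebra.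
From mathcomp Require Import ring lra zify.
Import Order.TTheory GRing.Theory Num.Theory.

Set Implicit Arguments.
Unset Strict Implicit.
Unset Printing Implicit Defensive.

Local Open Scope ring_scope.

(** * Directed paths, cuts and dual potentials *)

(** The obstacle is to extract combinatorial separation from continuous arcs. The plane is passed on
    only through two linear statements over the integers, [orthogonal] and [face_exact]. For a
    lattice both come from summation by parts, and both pass to minors, because deleting an edge
    merges its two faces and contracting it merges its ends. Separation then becomes arithmetic: a
    face potential that rises along all dual edges but drops by one at [e0] leaves room for a single
    unit of rise on the way round, and balanced cuts force comparability. The dual is required of
    every edge set, not just of the graph, because the induction over pieces uses it for each of
    them. Gluing dictates the strength of that induction: the order of a piece must begin with an
    edge leaving a prescribed vertex whenever the piece touches that vertex, so that the piece can
    be inserted there as an interval. *)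

Lemma connect_rind (T : finType) (r : rel T) x (P : T -> Prop) :
  P x -> (forall y z, connect r x y -> P y -> r y z -> P z) ->
  forall y, connect r x y -> P y.
Proof.
move=> Px IH y /connectP[p]; elim/last_ind: p y => [|p z IHp] y /= => [_ ->//|].
rewrite rcons_path last_rcons => /andP[xp rz] ->.
by apply: (IH (last x p)) => //; [apply/connectP; exists p | apply: IHp].
Qed.

Lemma connect_last (T : finType) (r : rel T) x y :
  connect r x y -> x != y -> exists2 z, connect r x z & r z y.
Proof.
move=> cxy; elim/connect_rind: y / cxy => [|y z cxy _ ryz _]; first by rewrite eqxx.
by exists y.
Qed.

Lemma connect_first (T : finType) (r : rel T) x y :
  connect r x y -> x != y -> exists2 z, r x z & connect r z y.
Proof.
move/connectP=> [[|z p] /= xp ->]; first by rewrite eqxx.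
by case/andP: xp => rz zp _; exists z => //; apply/connectP; exists p.
Qed.

(** Cuts of the graph pair to zero with differences of face potentials. Together with [face_exact]
    this makes the graph on the faces, with [e] running from [rg e] to [lf e], an algebraic dual. *)
Definition orthogonal (V E F : finType) (tl hd : E -> V) (lf rg : E -> F) :=
  forall (a : V -> int) (b : F -> int),
    \sum_e (a (hd e) - a (tl e)) * (b (lf e) - b (rg e)) = 0.

(** Kirchhoff's law in weak form: testing with the indicator of a vertex gives inflow minus outflow
    there. In this form potentials can be pulled back along maps of vertices. *)
Definition conserved (V E : finType) (tl hd : E -> V) (phi : E -> int) :=
  forall a : V -> int, \sum_e phi e * (a (hd e) - a (tl e)) = 0.

Definition face_exact (V E F : finType) (tl hd : E -> V) (lf rg : E -> F) :=
  forall phi : E -> int, conserved tl hd phi ->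
    exists g : F -> int, forall e, phi e = g (lf e) - g (rg e).

Section StGraph.
Variables (V E : finType) (tl hd : E -> V) (h : V -> nat) (s : V).
Hypothesis hlt : forall e, (h (tl e) < h (hd e))%N.
Hypothesis has_in : forall e, tl e != s -> exists e', hd e' = tl e.

Definition up : rel E := fun e f => hd e == tl f.

Lemma up_le e f : connect up e f -> (h (tl e) <= h (tl f))%N.
Proof.
move=> c; elim/connect_rind: f / c => // y z _ le /eqP yz.
by rewrite -yz (leq_trans le) // ltnW.
Qed.

Lemma up_lt e f : connect up e f -> e != f -> (h (hd e) <= h (tl f))%N.
Proof. by move=> /connect_first h1 /h1[z /eqP-> /up_le]. Qed.

Lemma up_anti e f : connect up e f -> connect up f e -> e = f.
Proof.
move=> ef fe; apply/eqP/negPn/negP => nef.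
have := up_lt ef nef; have := up_le fe; have := hlt e; lia.
Qed.

(** Going back along incoming edges lowers [h] and therefore ends at [s]; [psi] is the indicator of
    the path so traced. The last clause says weakly that it carries one unit from [s] to [hd e]. *)
Lemma down_flow e : exists psi : E -> int,
  [/\ forall k, 0 <= psi k, psi e = 1,
      forall k, psi k != 0 -> connect up k e &
      forall a : V -> int,
        \sum_k psi k * (a (hd k) - a (tl k)) = a (hd e) - a s].
Proof.
have [n] := ubnP (h (tl e)); elim: n e => // n IH e len.
have sum1 (w : E -> int) : \sum_k (k == e)%:R * w k = w e.
  rewrite (bigD1 e) //= eqxx mul1r big1 ?addr0 // => k /negbTE->; exact: mul0r.
have [tls|tls] := eqVneq (tl e) s.
  exists (fun k => (k == e)%:R); split=> [k||k|a].
  - exact: ler0n.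
  - by rewrite eqxx.
  - by have [->|] := eqVneq k e; rewrite ?connect0 ?eqxx.
  - by rewrite sum1 tls.
have [e' he'] := has_in tls.
have [|psi [psi0 psie' psic psia]] := IH e'.
  by rewrite (leq_trans (hlt _)) // he'.
exists (fun k => psi k + (k == e)%:R); split=> [k||k|a].
- by rewrite addr_ge0 ?ler0n.
- rewrite eqxx; suff -> : psi e = 0 by rewrite add0r.
  apply/eqP/negPn/negP => /psic /up_le.
  by have := hlt e'; rewrite he'; lia.
- case: (eqVneq k e) => [->|_]; first by rewrite connect0.
  rewrite addr0 => /psic c; apply: connect_trans c (connect1 _).
  exact/eqP.
- under eq_bigr do rewrite mulrDl.
  by rewrite big_split /= sum1 psia he'; ring.
Qed.

(** Extends the flow into [e] edge by edge along a directed path to [f]; the inequalities survive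
    each addition. *)
Lemma down_flow2 e f : connect up e f -> exists psi : E -> int,
  [/\ forall k, 0 <= psi k, 1 <= psi e, 1 <= psi f,
      forall k, psi k != 0 -> connect up k f &
      forall a : V -> int,
        \sum_k psi k * (a (hd k) - a (tl k)) = a (hd f) - a s].
Proof.
move=> c; elim/connect_rind: f / c => [|y z _ [psi [psi0 psie psiy psic psia]] yz].
  by have [psi [? pe ? ?]] := down_flow e; exists psi; split; rewrite ?pe.
have sum1 (w : E -> int) : \sum_k (k == z)%:R * w k = w z.
  rewrite (bigD1 z) //= eqxx mul1r big1 ?addr0 // => k /negbTE->; exact: mul0r.
exists (fun k => psi k + (k == z)%:R); split=> [k||| k|a].
- by rewrite addr_ge0 ?ler0n.
- by rewrite (le_trans psie) // lerDl ler0n.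
- by rewrite eqxx lerDr.
- case: (eqVneq k z) => [->|_]; first by rewrite connect0.
  by rewrite addr0 => /psic c; apply: connect_trans c (connect1 _).
- under eq_bigr do rewrite mulrDl.
  by rewrite big_split /= sum1 psia -(eqP yz); ring.
Qed.

End StGraph.

Definition noncrossing (E V : finType) (A : {set E}) (lt : rel E) (key : E -> V) :=
  forall a1 b1 a2 b2, a1 \in A -> b1 \in A -> a2 \in A -> b2 \in A ->
    lt a1 b1 -> lt b1 a2 -> lt a2 b2 ->
    key a1 = key a2 -> key b1 = key b2 -> key a1 = key b1.

Definition strict_total (E : finType) (A : {set E}) (lt : rel E) :=
  [/\ irreflexive lt, {in A & &, transitive lt} &
      {in A &, forall e f, e != f -> lt e f || lt f e}].

(* Upward planar orders restricted to an edge set, in local form: the third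
   clause says that nothing lies strictly between the last edge entering v and
   the first edge leaving v. *)
Definition planar_order (V E : finType) (A : {set E}) (tl hd : E -> V) (lt : rel E) :=
  [/\ strict_total A lt,
      {in A &, forall i o, hd i = tl o -> lt i o},
      forall v i o x, i \in A -> o \in A -> x \in A -> hd i = v -> tl o = v ->
        (exists i', [/\ i' \in A, hd i' = v & ~~ lt i' x]) \/
        (exists o', [/\ o' \in A, tl o' = v & ~~ lt x o']),
      noncrossing A lt hd & noncrossing A lt tl].

(** * The order of an st-graph built from its directed paths and dual paths *)

Section StDual.
Variables (V E F : finType) (tl hd : E -> V) (lf rg : E -> F).
Variables (h : V -> nat) (e0 : E).
Hypothesis hlt : forall e, (h (tl e) < h (hd e))%N.
Hypothesis has_in : forall e, tl e != tl e0 -> exists e', hd e' = tl e.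
Hypothesis has_out : forall e, hd e != hd e0 -> exists e', tl e' = hd e.
Hypothesis source0 : forall e, hd e != tl e0.
Hypothesis sink0 : forall e, tl e != hd e0.
Hypothesis orth : orthogonal tl hd lf rg.
Hypothesis exct : face_exact tl hd lf rg.

Notation ge := (connect (up tl hd)).

(* A step from e to the next edge e' of a directed dual path; excluding e0 as a
   target cuts the dual circuits open at e0. *)
Definition across : rel E := fun e f => (lf e == rg f) && (f != e0).
Notation dl := (connect across).

Lemma up_e0 e : ge e e0 -> e = e0.
Proof.
move=> c; apply/eqP/negPn/negP => ne; have [z _ /eqP zt] := connect_last c ne.
by have := source0 z; rewrite zt eqxx.
Qed.

Lemma e0_up e : ge e0 e -> e = e0.
Proof.
move=> c; apply/eqP/negPn/negP; rewrite eq_sym => ne.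
have [z /eqP zt _] := connect_first c ne.
by have := sink0 z; rewrite -zt eqxx.
Qed.

Lemma across_e0 e : dl e e0 -> e = e0.
Proof.
move=> c; apply/eqP/negPn/negP => /(connect_last c)[z _ /andP[_]].
by rewrite eqxx.
Qed.

Lemma up_flow e : exists psi : E -> int,
  [/\ forall k, 0 <= psi k, forall k, psi k != 0 -> ge e k &
      forall a : V -> int,
        \sum_k psi k * (a (hd k) - a (tl k)) = a (hd e0) - a (tl e)].
Proof.
(* Reverse all edges, with heights [N - h v]: a flow from [hd e0] to [tl e] in the reversed graph is
   the wanted one up to sign. *)
pose N := (\max_v h v)%N.
have hN v : (h v <= N)%N by apply: leq_bigmax.
have hlt' k : (N - h (hd k) < N - h (tl k))%N.
  by have := hlt k; have := hN (hd k); have := hN (tl k); lia.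
have [psi [psi0 _ psic psia]] :=
  @down_flow _ _ hd tl (fun v => N - h v)%N _ hlt' has_out e.
exists psi; split=> // [k /psic|a].
  have -> : connect (up hd tl) k e = connect (fun x y => up tl hd y x) k e.
    by apply: eq_connect => x y; rewrite /up eq_sym.
  by rewrite connect_rev.
rewrite -[RHS]opprK opprB -psia -sumrN; apply: eq_bigr => k _; ring.
Qed.

(** A flow from the source through [e] and [f] to the sink, returned along [e0] with value -1, is a
    circulation, and [g] is its face potential. Off [e0] the flow is nonnegative, which makes [g]
    monotone. *)
Lemma circulation e f : e != e0 -> f != e0 -> ge e f -> exists g : F -> int,
  [/\ forall k, k != e0 -> g (rg k) <= g (lf k),
      g (rg e) + 1 <= g (lf e), g (rg f) + 1 <= g (lf f) &
      g (lf e0) + 1 = g (rg e0)].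
Proof.
move=> ne nf ef.
have [psi [psi0 psie psif psic psia]] := down_flow2 hlt has_in ef.
have psi_e0 : psi e0 = 0.
  by apply/eqP/negPn/negP => /psic/e0_up fe0; rewrite fe0 eqxx in nf.
have [psi' [psi'0 psi'_e0 psi'a]] : exists psi' : E -> int,
    [/\ forall k, 0 <= psi' k, psi' e0 = 0 & forall a : V -> int,
        \sum_k psi' k * (a (hd k) - a (tl k)) = a (hd e0) - a (hd f)].
  have [->|hdf] := eqVneq (hd f) (hd e0).
    exists (fun=> 0); split=> // a; rewrite subrr big1 // => k _; exact: mul0r.
  have [f' ff'] := has_out hdf; rewrite -ff'.
  have [psi' [? psi'c ?]] := up_flow f'; exists psi'; split=> //.
  apply/eqP/negPn/negP => /psi'c/up_e0 E1; subst f'.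
  by have := source0 f; rewrite ff' eqxx.
pose phi k := psi k + psi' k - (k == e0)%:R.
have sum1 (w : E -> int) : \sum_k (k == e0)%:R * w k = w e0.
  rewrite (bigD1 e0) //= eqxx mul1r big1 ?addr0 // => k /negbTE->; exact: mul0r.
have /exct[g gE] : conserved tl hd phi.
  move=> a; under eq_bigr do rewrite mulrBl mulrDl.
  by rewrite sumrB big_split /= psia psi'a sum1; ring.
exists g; split=> [k /negbTE nk|||].
- have := gE k; rewrite /phi nk; have := psi0 k; have := psi'0 k; lia.
- have := gE e; rewrite /phi (negbTE ne); have := psi'0 e; lia.
- have := gE f; rewrite /phi (negbTE nf); have := psi'0 f; lia.
- have := gE e0; rewrite /phi psi_e0 psi'_e0 eqxx; lia.
Qed.

Lemma across_le (g : F -> int) x y :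
  (forall k, k != e0 -> g (rg k) <= g (lf k)) -> dl x y -> g (lf x) <= g (lf y).
Proof.
move=> gm c; elim/connect_rind: y / c => // y z _ le /andP[/eqP yz /gm].
by rewrite -yz; apply: le_trans.
Qed.

Lemma across_lt (g : F -> int) x y :
  (forall k, k != e0 -> g (rg k) <= g (lf k)) -> dl x y -> x != y ->
  g (lf x) <= g (rg y).
Proof.
by move=> gm c /(connect_last c)[z /(across_le gm) le /andP[/eqP <- _]].
Qed.

(** A dual circuit avoiding [e0] would strictly raise the potential of a circulation through [x]. *)
Lemma across_anti x y : dl x y -> dl y x -> x = y.
Proof.
move=> xy yx; have [x0|nx] := eqVneq x e0.
  by rewrite x0 in yx *; rewrite (across_e0 yx).
have [y0|ny] := eqVneq y e0.
  by rewrite y0 in xy *; rewrite (across_e0 xy).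
apply/eqP/negPn/negP => nxy.
have [g [gm gx _ _]] := circulation nx nx (connect0 _ _).
have := across_lt gm yx; rewrite eq_sym nxy => /(_ isT).
have := across_le gm xy; lia.
Qed.

(** * Dual paths along a cut through an antichain *)

Section Cut.
Variable K : {set E}.
Hypothesis antichain : {in K &, forall k k', ge k k' -> k = k'}.
Hypothesis K0 : exists k, k \in K.

(** Closed under passing from the head of an edge to its tail, so that every edge between [below]
    and its complement crosses upwards. *)
Definition below : {set V} :=
  [set x | [exists e, exists k in K, (tl e == x) && ge e k]].
Definition cut : {set E} := [set e | (tl e \in below) && (hd e \notin below)].

Lemma belowP x :
  reflect (exists e k, [/\ k \in K, tl e = x & ge e k]) (x \in below).
Proof.
rewrite inE; apply: (iffP existsP) => [[e /exists_inP[k kK /andP[/eqP ? ?]]]|].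
  by exists e, k.
by case=> e [k [kK <- ek]]; exists e; apply/exists_inP; exists k; rewrite ?eqxx.
Qed.

Lemma below_down e : hd e \in below -> tl e \in below.
Proof.
move=> /belowP[f [k [kK fe fk]]]; apply/belowP; exists e, k; split=> //.
by apply: connect_trans fk; apply: connect1; apply/eqP.
Qed.

Lemma cut_K : {in K, forall k, k \in cut}.
Proof.
move=> k kK; rewrite inE; apply/andP; split; first by apply/belowP; exists k, k.
apply/negP => /belowP[e [k' [k'K ek ek']]].
have ke : up tl hd k e by apply/eqP.
have kk' := connect_trans (connect1 ke) ek'.
have E1 := antichain kK k'K kk'; subst k'.
have E2 := up_anti hlt (connect1 ke) ek'; subst e.
by have := hlt k; rewrite {1}ek ltnn.
Qed.

Lemma cut_e0 : e0 \in cut.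
Proof.
rewrite inE; apply/andP; split.
  case: K0 => k kK; have [n] := ubnP (h (tl k)).
  suff: forall e, ge e k -> (h (tl e) < n)%N -> tl e0 \in below.
    by move=> /(_ k (connect0 _ _)).
  elim: n => // n IH e ek len.
  have [<-|/has_in[e' he']] := eqVneq (tl e) (tl e0).
    by apply/belowP; exists e, k.
  apply: (IH e'); last by have := hlt e'; rewrite he'; lia.
  by apply: connect_trans ek; apply: connect1; apply/eqP.
by apply/negP => /belowP[e [k [_ te _]]]; have := sink0 e; rewrite te eqxx.
Qed.

Lemma cut_below e k : e \in cut -> k \in K -> ge e k -> e = k.
Proof.
rewrite inE => /andP[_ ne] kK ek; apply/eqP/negPn/negP => nek.
have [z /eqP ez zk] := connect_first ek nek.
by case/negP: ne; apply/belowP; exists z, k.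
Qed.

(** Orthogonality for the indicators of the complement of [below] and of [S]: in the dual graph, as
    many edges of the cut enter [S] as leave it. *)
Lemma cut_balance (S : {set F}) :
  \sum_(e in cut) ((lf e \in S)%:R - (rg e \in S)%:R) = 0 :> int.
Proof.
rewrite -[RHS](orth (fun x => (x \notin below)%:R) (fun f => (f \in S)%:R)).
rewrite [LHS]big_mkcond; apply: eq_bigr => e _.
rewrite inE; have := @below_down e.
case: (hd e \in below) => /= [->//|_]; first by rewrite subrr mul0r.
by case: (tl e \in below); rewrite /= ?subrr ?mul0r ?subr0 ?mul1r.
Qed.

Definition across_cut : rel E := fun e f => across e f && (f \in cut).
Notation dc := (connect across_cut).

Lemma dc_dl x y : dc x y -> dl x y.
Proof.
by apply: connect_sub => ? ? /andP[? _]; apply: connect1.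
Qed.

Definition reach f : {set F} := [set x | [exists z, dc f z && (lf z == x)]].

Lemma reachP f x : reflect (exists2 z, dc f z & lf z = x) (x \in reach f).
Proof.
rewrite inE; apply: (iffP existsP) => [[z /andP[? /eqP]]|[z fz <-]]; first by exists z.
by exists z; rewrite fz /=.
Qed.

Lemma reach_closed f k :
  k \in cut -> k != e0 -> rg k \in reach f -> lf k \in reach f.
Proof.
move=> kB nk /reachP[z fz zk]; apply/reachP; exists k => //.
by apply: connect_trans fz (connect1 _); rewrite /across_cut /across zk eqxx nk.
Qed.

Lemma loopfree x : x != e0 -> lf x != rg x.
Proof.
move=> nx; have [g [_ gx _ _]] := circulation nx nx (connect0 _ _).
by apply/eqP => E1; move: gx; rewrite E1; lia.
Qed.

Lemma reach_self f : f \in cut -> f != e0 ->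
  lf f \in reach f /\ rg f \notin reach f.
Proof.
move=> fB nf; split; first by apply/reachP; exists f.
apply/negP => /reachP[z fz zf].
have zdf : across z f by rewrite /across zf eqxx.
have := across_anti (dc_dl fz) (connect1 zdf) => E1; subst z.
by have := loopfree nf; rewrite zf eqxx.
Qed.

(** The edge [f] enters [reach f], and no cut edge except [e0] can leave it. Balance makes [e0]
    leave; since [f] already makes up for that, no further edge enters. *)
Lemma cut_out f : f \in cut -> f != e0 ->
  [/\ rg e0 \in reach f, lf e0 \notin reach f &
    forall k, k \in cut -> k != e0 -> k != f ->
      rg k \notin reach f -> lf k \notin reach f].
Proof.
move=> fB nf; have [lfr rgr] := reach_self fB nf.
have := cut_balance (reach f).
rewrite (bigD1 e0) ?cut_e0 //= (bigD1 f) /= ?fB // lfr (negbTE rgr).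
set T := (X in _ + (_ + X)).
have pos k : k \in cut -> k != e0 ->
    0 <= (lf k \in reach f)%:R - (rg k \in reach f)%:R :> int.
  move=> kB nk; have := @reach_closed f k kB nk.
  by case: (rg k \in _) => [/(_ isT)->//|_]; case: (lf k \in _).
have T0 : 0 <= T.
  by apply: sumr_ge0 => k /andP[/andP[kB nk] _]; apply: pos.
move=> bal.
have [le0 re0] : lf e0 \notin reach f /\ rg e0 \in reach f.
  by move: bal T0; case: (lf e0 \in _); case: (rg e0 \in _) => //=; lia.
split=> // k kB nk nkf rk; apply/negP => lk.
have : 1 <= T.
  rewrite /T (bigD1 k) /= ?kB ?nk // lk (negbTE rk) subr0 lerDl.
  by apply: sumr_ge0 => k' /andP[/andP[/andP[kB' nk'] _] _]; apply: pos.
by move: bal; rewrite (negbTE le0) re0 sub0r subr0 addKr => ->.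
Qed.

(** The mirror argument, with [P] the set of right faces of cut edges leading to [f]: here [f]
    leaves [P] and only [e0] can enter it. *)
Lemma cut_in f : f \in cut -> dc e0 f.
Proof.
move=> fB; have [->|nf] := eqVneq f e0; first exact: connect0.
pose P : {set F} := [set x | [exists z,
  [&& z \in cut, z != e0, dc z f & rg z == x]]].
have PP x : reflect (exists z, [/\ z \in cut, z != e0, dc z f & rg z = x]) (x \in P).
  rewrite inE; apply: (iffP existsP) => [[z /and4P[? ? ? /eqP]]|[z [? ? ? <-]]].
    by exists z.
  by exists z; apply/and4P; split.
have lkP k : k \in cut -> lf k \in P -> dc k f.
  move=> kB /PP[z [zB nz zf zk]]; apply: connect_trans (connect1 _) zf.
  by rewrite /across_cut /across zk eqxx nz.
apply: (lkP e0); first exact: cut_e0.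
have := cut_balance P; rewrite (bigD1 e0) ?cut_e0 //= (bigD1 f) /= ?fB //.
have -> : rg f \in P by apply/PP; exists f.
have -> : (lf f \in P) = false.
  apply/negP => /PP[z [zB nz zf fz]].
  have dfz : across f z by rewrite /across fz eqxx.
  have E1 := across_anti (connect1 dfz) (dc_dl zf); subst z.
  by have := loopfree nf; rewrite fz eqxx.
set T := (X in _ + (_ + X)).
have : T <= 0.
  apply: sumr_le0 => k /andP[/andP[kB nk] _].
  case: (boolP (lf k \in P)) => [/(lkP _ kB) kf|_]; last by rewrite sub0r oppr_le0 ler0n.
  by have -> : rg k \in P by apply/PP; exists k.
by case: (lf e0 \in P); case: (rg e0 \in P) => //=; lia.
Qed.

(** If neither edge leads to the other, [e0] leaves the intersection of [reach e] and [reach f]. By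
    [cut_out] the only candidates to enter one of these sets are [e] and [f], and neither enters the
    intersection, against balance. *)
Lemma cut_total e f : e \in cut -> f \in cut -> dc e f \/ dc f e.
Proof.
move=> eB fB; have [->|ne] := eqVneq e e0; first by left; apply: cut_in.
have [->|nf] := eqVneq f e0; first by right; apply: cut_in.
have [->|nef] := eqVneq e f; first by left; apply: connect0.
have [re le ue] := cut_out eB ne; have [rf le' uf] := cut_out fB nf.
have dcP x y : y \in cut -> y != e0 -> rg y \in reach x -> dc x y.
  move=> yB ny /reachP[z xz zy]; apply: connect_trans xz (connect1 _).
  by rewrite /across_cut /across zy eqxx ny.
case: (boolP (rg f \in reach e)) => [/dcP|ref]; first by left; auto.
case: (boolP (rg e \in reach f)) => [/dcP|rfe]; first by right; auto.
exfalso.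
have := cut_balance (reach e :&: reach f).
rewrite (bigD1 e0) ?cut_e0 //= big1 => [|k /andP[kB nk]].
  by rewrite !in_setI re rf (negbTE le).
rewrite !in_setI.
case: (boolP (rg k \in reach e)) => rke; last first.
  have [ke|nke] := eqVneq k e.
    subst k; have /negbTE-> := uf _ eB ne nef rfe.
    by rewrite andbF subrr.
  by rewrite (negbTE (ue _ kB nk nke rke)) subrr.
rewrite (reach_closed kB nk rke) /=.
case: (boolP (rg k \in reach f)) => rkf.
  by rewrite (reach_closed kB nk rkf) subrr.
have [kf|nkf] := eqVneq k f.
  by subst k; rewrite rke in ref.
by rewrite (negbTE (uf _ kB nk nkf rkf)) subrr.
Qed.

End Cut.

Lemma antichain1 e : {in [set e] &, forall k k', ge k k' -> k = k'}.
Proof. by move=> k k' /set1P-> /set1P->. Qed.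

Lemma e0_across e : dl e0 e.
Proof.
have K0 : exists k, k \in [set e] by exists e; rewrite set11.
exact/dc_dl/(cut_in K0)/(cut_K (@antichain1 e))/set11.
Qed.

(** A dual path from [e0] through [e] and [f] and back to the right face of [e0] would raise the
    potential of a circulation through both edges by at least two, while the drop at [e0] is one. *)
Lemma up_across e f : ge e f \/ ge f e -> dl e f -> e = f.
Proof.
move=> gef def; apply/eqP/negPn/negP => nef.
have nf : f != e0 by apply: contraNneq nef => fe0; rewrite fe0 in def *; rewrite (across_e0 def).
have ne : e != e0.
  by apply: contraNneq nef => E1; move: gef; rewrite E1 => -[/e0_up|/up_e0] ->.
have [g [gm ge_ gf ge0]] : exists g : F -> int,
  [/\ forall k, k != e0 -> g (rg k) <= g (lf k),
      g (rg e) + 1 <= g (lf e), g (rg f) + 1 <= g (lf f) &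
      g (lf e0) + 1 = g (rg e0)].
  by case: gef => /circulation => [/(_ ne nf)|/(_ nf ne)] [g [? ? ? ?]]; exists g.
have := across_lt gm (e0_across e); rewrite eq_sym ne => /(_ isT) h1.
have := across_lt gm def nef.
have K0 : exists k, k \in [set f] by exists f; rewrite set11.
have [/reachP[z fz zE] _ _] := cut_out K0 (cut_K (@antichain1 f) (set11 f)) nf.
have := across_le gm (dc_dl fz); rewrite zE; lia.
Qed.

Definition st_le e f := ge e f || dl e f.

Lemma across_total e f : ~~ ge e f -> ~~ ge f e -> dl e f \/ dl f e.
Proof.
move=> nef nfe.
have anti : {in [set e; f] &, forall k k', ge k k' -> k = k'}.
  move=> k k' /set2P[]-> /set2P[]-> //; by rewrite ?(negbTE nef) ?(negbTE nfe).
have K0 : exists k, k \in [set e; f] by exists e; rewrite set21.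
have eB := cut_K anti (set21 e f); have fB := cut_K anti (set22 e f).
by case: (cut_total K0 eB fB) => /dc_dl; [left|right].
Qed.

Lemma st_le_total : total st_le.
Proof.
move=> e f; rewrite /st_le; case: (boolP (ge e f)) => //= nef.
case: (boolP (ge f e)) => [|nfe]; first by rewrite orbT.
by case: (across_total nef nfe) => ->; rewrite ?orbT.
Qed.

Lemma st_le_anti : antisymmetric st_le.
Proof.
move=> e f /andP[/orP[] ef /orP[] fe].
- exact: (up_anti hlt).
- by apply/esym/up_across => //; right.
- by apply: up_across => //; right.
- exact: across_anti.
Qed.

Lemma st_le_trans : transitive st_le.
Proof.
move=> f e k ef fk.
(* By totality it remains to collapse a cycle [e], [f], [k]. Two of its three relations are of the
   same kind and compose, which leaves a pair for [up_anti], [across_anti] or [up_across]. *)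
case/orP: (st_le_total e k) => [//|ke].
suff -> : e = k by rewrite /st_le connect0.
have mix x y z : ge x y -> dl y z -> st_le z x -> x = z.
  move=> xy yz /orP[zx|zx].
    have yz' := up_across (or_intror (connect_trans zx xy)) yz; subst z.
    exact: (up_anti hlt).
  have yx := up_across (or_intror xy) (connect_trans yz zx); subst y.
  exact: across_anti.
have mix' x y z : dl x y -> ge y z -> st_le z x -> x = z.
  move=> xy yz /orP[zx|zx].
    have xy' := up_across (or_intror (connect_trans yz zx)) xy; subst y.
    exact: (up_anti hlt).
  have zy := up_across (or_intror yz) (connect_trans zx xy); subst y.
  exact: across_anti.
case/orP: ef fk => [ef /orP[fk|fk]|ef /orP[fk|fk]].
- case/orP: ke => ke.
    have ke' := connect_trans ke ef.
    have E1 := up_anti hlt fk ke'; subst f; exact: (up_anti hlt).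
  by apply/esym/up_across => //; right; apply: connect_trans fk.
- exact: mix ef fk ke.
- exact: mix' ef fk ke.
- case/orP: ke => ke.
    by apply: up_across (or_intror ke) (connect_trans ef fk).
  exact: across_anti (connect_trans ef fk) ke.
Qed.

Lemma dc_const (K : {set E}) (g : F -> int) x y :
  (forall z, z \in cut K -> dl x z -> dl z y -> z != x -> z != y ->
     g (lf z) = g (rg z)) ->
  x \in cut K -> connect (across_cut K) x y -> x != y -> g (rg y) = g (lf x).
Proof.
move=> const xB xy nxy.
suff: forall z, connect (across_cut K) x z -> dl z y -> x != z -> g (rg z) = g (lf x).
  by apply.
move=> z xz; elim/connect_rind: z / xz => [|w z xw IH wz].
  by rewrite eqxx.
move=> zy nxz; have /andP[/andP[/eqP <- nz] zB] := wz.
have wz' : dl w z by apply: connect1; case/andP: wz.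
have [->//|nxw] := eqVneq x w.
have wB : w \in cut K.
  by have [? _ /andP[]] := connect_last xw nxw.
have wy := connect_trans wz' zy.
have [wy'|nwy] := eqVneq w y.
  subst w; have zy' := across_anti zy wz'; subst z.
  have /andP[/andP[/eqP E1 ny] _] := wz.
  by have := loopfree ny; rewrite E1 eqxx.
rewrite (const w) //; [exact: IH|exact: dc_dl xw|by rewrite eq_sym].
Qed.

(* The flow [s ~> a1] minus [s ~> a2] has a face potential that changes along the
   cut only at a1 and a2, hence differs at b1 and b2; but it is constant around
   the common head of b1 and b2, which it does not meet. *)
Lemma cross_in a1 b1 a2 b2 : dl a1 b1 -> dl b1 a2 -> dl a2 b2 ->
  hd a1 = hd a2 -> hd b1 = hd b2 -> hd a1 = hd b1.
Proof.
move=> ab1 ba ab2 ha hb; apply/eqP/negPn/negP => nab.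
have na1b1 : a1 != b1 by apply: contraNneq nab => ->.
have nb1a2 : b1 != a2 by apply: contraNneq nab => ->; rewrite ha.
have na2b2 : a2 != b2 by apply: contraNneq nab => E1; rewrite ha hb E1.
have na1a2 : a1 != a2.
  by apply: contraNneq na1b1 => E1; apply/eqP/across_anti => //; rewrite E1.
have ndl x y : dl x y -> x != y -> ~~ ge x y /\ ~~ ge y x.
  by move=> xy nxy; split; apply: contraNN nxy => c; apply/eqP/up_across; auto.
have anb : a1 != b2.
  apply: contraNneq na1b1 => E1; apply/eqP/across_anti => //.
  by rewrite E1; apply: connect_trans ab2.
have nb1b2 : b1 != b2.
  by apply: contraNneq nb1a2 => E1; apply/eqP/across_anti => //; rewrite E1.
have da1a2 := connect_trans ab1 ba.
have da1b2 := connect_trans da1a2 ab2.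
have db1b2 := connect_trans ba ab2.
pose K := [set a1; b1; a2; b2].
have [? ?] := ndl _ _ ab1 na1b1; have [? ?] := ndl _ _ ba nb1a2.
have [? ?] := ndl _ _ ab2 na2b2; have [? ?] := ndl _ _ da1a2 na1a2.
have [? ?] := ndl _ _ da1b2 anb; have [? ?] := ndl _ _ db1b2 nb1b2.
have anti : {in K &, forall k k', ge k k' -> k = k'}.
  move=> k k'; rewrite !inE -!orbA => /or4P[]/eqP-> /or4P[]/eqP-> // c;
  by exfalso; move: c; apply/negP.
have K0 : exists k, k \in K by exists a1; rewrite !inE eqxx.
have a1K : a1 \in K by rewrite !inE eqxx.
have b1K : b1 \in K by rewrite !inE eqxx ?orbT.
have a2K : a2 \in K by rewrite !inE eqxx ?orbT.
have b2K : b2 \in K by rewrite !inE eqxx ?orbT.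
have dcI x y : x \in K -> y \in K -> dl x y -> x != y -> connect (across_cut K) x y.
  move=> xK yK xy nxy.
  case: (cut_total K0 (cut_K anti xK) (cut_K anti yK)) => // /dc_dl yx.
  by case/eqP: nxy; apply: across_anti.
have [psi1 [_ psi1a psi1c psi1s]] := down_flow hlt has_in a1.
have [psi2 [_ psi2a psi2c psi2s]] := down_flow hlt has_in a2.
have [psi3 [_ psi3a psi3c psi3s]] := down_flow hlt has_in b1.
have [psi4 [_ psi4a psi4c psi4s]] := down_flow hlt has_in b2.
have /exct[g gE] : conserved tl hd (fun k => psi1 k - psi2 k).
  move=> a; under eq_bigr do rewrite mulrBl.
  by rewrite sumrB psi1s psi2s ha; ring.
have /exct[g' g'E] : conserved tl hd (fun k => psi3 k - psi4 k).
  move=> a; under eq_bigr do rewrite mulrBl.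
  by rewrite sumrB psi3s psi4s hb; ring.
have psi0 psi x k : (forall k, psi k != 0 -> ge k x) -> ~~ ge k x -> psi k = 0 :> int.
  by move=> c nkx; apply/eqP; apply: contraNT nkx => /c.
have gB z : z \in cut K -> z != a1 -> z != a2 -> g (lf z) = g (rg z).
  move=> zB nz1 nz2; have := gE z.
  rewrite (psi0 psi1 a1) ?(psi0 psi2 a2) //; first by move/esym/eqP; rewrite subr0 subr_eq0 => /eqP.
  - by apply: contraNN nz2 => /(cut_below zB a2K)->.
  - by apply: contraNN nz1 => /(cut_below zB a1K)->.
have gb1 : g (rg b1) = g (lf a1).
  apply: (@dc_const K) => [z zB a1z zb1 nz1 nzb||| //].
  - apply: gB => //; apply: contraNneq nb1a2 => E1; subst z.
    exact/eqP/across_anti.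
  - exact: cut_K.
  - exact: dcI.
have ga2 : g (rg a2) = g (lf a1).
  apply: (@dc_const K) => [z zB a1z zb1 nz1 nzb||| //].
  - exact: gB.
  - exact: cut_K.
  - exact: dcI.
have gb2 : g (rg b2) = g (lf a2).
  apply: (@dc_const K) => [z zB a1z zb1 nz1 nzb||| //].
  - apply: gB => //; apply: contraNneq na1a2 => E1; subst z.
    exact/eqP/across_anti.
  - exact: cut_K.
  - exact: dcI.
have ga2' : g (lf a2) = g (rg a2) - 1.
  have := gE a2; rewrite psi2a (psi0 psi1 a1) // sub0r => /esym/eqP.
  by rewrite subr_eq addrC => /eqP.
(* A directed path from an edge at [hd b1] to [a1] or [a2] could be restarted from [b1] and from
   [b2], which do not reach those edges. So both flows vanish at this vertex. *)
have star k : hd k = hd b1 \/ tl k = hd b1 -> g (lf k) = g (rg k).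
  move=> hk; have := gE k; have nk x : hd x = hd a1 -> ~~ ge b1 x \/ ~~ ge b2 x -> ~~ ge k x.
    move=> hx nx; apply/negP => kx.
    have [tk|ntk] := eqVneq (tl k) (hd b1).
      have b1k : up tl hd b1 k by rewrite /up tk.
      have b2k : up tl hd b2 k by rewrite /up tk hb.
      by case: nx => /negP; apply; apply: connect_trans kx; apply: connect1.
    case: hk => [hk|/eqP]; last by rewrite (negbTE ntk).
    have [E1|nkx] := eqVneq k x; first by subst x; case/eqP: nab; rewrite -hx hk.
    have [z kz zx] := connect_first kx nkx.
    have b1z : up tl hd b1 z by rewrite /up -hk.
    have b2z : up tl hd b2 z by rewrite /up -hb -hk.
    by case: nx => /negP; apply; apply: connect_trans zx; apply: connect1.
  rewrite (psi0 psi1 a1) ?(psi0 psi2 a2) //; first by move/esym/eqP; rewrite subr0 subr_eq0 => /eqP.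
  - by apply: nk; rewrite ?ha; auto.
  - by apply: nk; rewrite ?ha; auto.
pose c := g (rg b1).
(* The vertex test function singles out [hd b1]. By [star] the level set [g = c] can be factored out
   of each term there, and what remains is the jump of [g']: it is 1 at [b1], -1 at [b2] and 0 at
   the other edges of the vertex. Only [b1] lies in the level set, since [g] is [c - 1] at [b2]; so
   the vanishing sum would be 1. *)
have := orth (fun x => (x == hd b1)%:R) (fun f => (g f == c)%:R * g' f).
have psi_hd psi x k : (forall k, psi k != 0 -> ge k x) -> psi x = 1 ->
    hd x = hd b1 -> hd k = hd b1 -> psi k = (k == x)%:R :> int.
  move=> pc px hx hk; have [->|nkx] := eqVneq k x; first by rewrite px.
  apply: psi0 pc _; apply/negP => kx.
  have [z /eqP kz zx] := connect_first kx nkx.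
  by have := up_le hlt zx; rewrite -kz hk -hx leqNgt hlt.
have psi_tl psi x k : (forall k, psi k != 0 -> ge k x) ->
    hd x = hd b1 -> tl k = hd b1 -> psi k = 0 :> int.
  move=> pc hx tk; apply: psi0 pc _; apply/negP => kx.
  by have := up_le hlt kx; rewrite tk -hx leqNgt hlt.
rewrite (bigD1 b1) //= (bigD1 b2) /=; last by rewrite eq_sym.
rewrite big1 => [|k /andP[nk1 nk2]]; last first.
  have [hk|nhk] := eqVneq (hd k) (hd b1).
    have := g'E k; rewrite (psi_hd psi3 b1) // (psi_hd psi4 b2) // (star k); last by left.
    rewrite (negbTE nk1) (negbTE nk2) => E1.
    by rewrite -mulrBr -E1 subrr !mulr0.
  have [tk|ntk] := eqVneq (tl k) (hd b1).
    have := g'E k; rewrite (psi_tl psi3 b1) // (psi_tl psi4 b2) // (star k); last by right.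
    by rewrite -mulrBr => <-; rewrite subrr !mulr0.
  by rewrite subrr mul0r.
have tlb x : hd x = hd b1 -> (tl x == hd b1) = false.
  by move=> <-; apply/negP => /eqP E1; have := hlt x; rewrite E1 ltnn.
rewrite -hb eqxx !tlb // subr0 !mul1r addr0.
rewrite (star b1); last by left.
rewrite (star b2); last by left.
rewrite -!mulrBr -!g'E.
rewrite (psi_hd psi3 b1) // (psi_hd psi4 b2) // (psi_hd psi3 b1) // (psi_hd psi4 b2) //.
rewrite !eqxx (eq_sym b2 b1) !(negbTE nb1b2).
have -> : (g (rg b2) == c) = false.
  by rewrite gb2 ga2' ga2 -gb1 -/c -subr_eq0 addrAC subrr.
by [].
Qed.

Definition st_lt e f := (e != f) && st_le e f.

Lemma st_ltP e f : st_lt e f -> ~~ st_le f e.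
Proof.
case/andP=> nef ef; apply: contraNN nef => fe.
by rewrite (st_le_anti (introT andP (conj ef fe))).
Qed.

Lemma st_up_irr e f : st_lt e f -> ~~ ge f e.
Proof. by move/st_ltP; rewrite negb_or => /andP[]. Qed.

Lemma st_across e f : st_lt e f -> ~~ ge e f -> dl e f.
Proof. by case/andP=> _ /orP[->|]. Qed.

Lemma ge_same_hd a b x : hd a = hd b -> ge a x -> a != x -> ge b x.
Proof.
move=> hab ax nax; have [z /eqP az zx] := connect_first ax nax.
by apply: connect_trans zx; apply: connect1; rewrite /up -hab az.
Qed.

Lemma ge_same_tl a b x : tl a = tl b -> ge x a -> x != a -> ge x b.
Proof.
move=> hab xa nxa; have [z xz /eqP za] := connect_last xa nxa.
by apply: connect_trans xz _; apply: connect1; rewrite /up -hab za.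
Qed.

Lemma up_acyclic a b : ge a b -> hd b <> tl a.
Proof. by move=> /(up_le hlt) ab E1; have := leq_ltn_trans ab (hlt b); rewrite E1 ltnn. Qed.

Lemma st_lt_neq e f : st_lt e f -> e != f. Proof. by case/andP. Qed.

Lemma st_lt_total e f : e != f -> st_lt e f || st_lt f e.
Proof.
by move=> nef; rewrite /st_lt nef eq_sym nef; apply: st_le_total.
Qed.

(** Directed paths leaving an edge depend only on its head, so a path from [a1] to [b1] would give
    one from [a2] to [b1], against the order; likewise for [b1] and [a2]. Hence the first two
    comparisons are dual paths, as [cross_in] wants. *)
Lemma st_noncrossing_hd : noncrossing setT st_lt hd.
Proof.
move=> a1 b1 a2 b2 _ _ _ _ ab1 ba ab2 ha hb.
have [//|nab] := eqVneq (hd a1) (hd b1).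
have n1 : ~~ ge a1 b1.
  by apply: contraNN (st_up_irr ba) => c; apply: ge_same_hd (st_lt_neq ab1).
have n2 : ~~ ge b1 a2.
  by apply: contraNN (st_up_irr ab2) => c; apply: ge_same_hd (st_lt_neq ba).
have d1 := st_across ab1 n1; have d2 := st_across ba n2.
case: (boolP (ge a2 b2)) => [c|n3]; last exact: (cross_in d1 d2 (st_across ab2 n3)).
(* The edge [o] that follows the common head of [a1] and [a2] can be compared with [b1] only by a
   dual path. Continuing [d1], or continued by [d2], that path joins [o] to [a1] or [a2], to which
   [o] is also joined by a directed step. *)
exfalso; have [o /eqP a2o ob2] := connect_first c (st_lt_neq ab2).
have a2o' : ge a2 o by apply: connect1; rewrite /up a2o.
have a1o : ge a1 o by apply: connect1; rewrite /up ha a2o.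
have nbo : ~~ ge b1 o.
  apply/negP => b1o; have [E1|nbo] := eqVneq b1 o.
    by case/negP: n1; rewrite E1.
  have := leq_ltn_trans (leq_trans (up_lt hlt b1o nbo) (up_le hlt ob2)) (hlt b2).
  by rewrite hb ltnn.
have nob : ~~ ge o b1 by apply: contraNN n1; apply: connect_trans.
case: (across_total nbo nob) => [b1o|ob1].
  have E1 := up_across (or_introl a1o) (connect_trans d1 b1o).
  by apply: (up_acyclic (connect0 _ a1)); rewrite ha a2o E1.
have E1 := up_across (or_intror a2o') (connect_trans ob1 d2).
by apply: (up_acyclic (connect0 _ a2)); rewrite a2o E1.
Qed.

(** A directed path from [i] to [x] starts with an edge leaving [v], and one from [x] to [o] ends
    with an edge entering [v]; either one gives the claim. Otherwise dual paths join [i] to [o],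
    although [o] directly follows [i]. *)
Lemma st_consecutive v i o x : hd i = v -> tl o = v ->
  (exists i', hd i' = v /\ ~~ st_lt i' x) \/ (exists o', tl o' = v /\ ~~ st_lt x o').
Proof.
move=> hi to.
case: (boolP (st_lt i x)) => ix; last by left; exists i.
case: (boolP (st_lt x o)) => xo; last by right; exists o.
have io : ge i o by apply: connect1; rewrite /up hi to.
case: (boolP (ge i x)) => nix.
  have [z /eqP iz zx] := connect_first nix (st_lt_neq ix).
  right; exists z; split; first by rewrite -iz.
  by apply/negP => /st_ltP; rewrite /st_le zx.
case: (boolP (ge x o)) => nxo.
  have [z xz /eqP zo] := connect_last nxo (st_lt_neq xo).
  left; exists z; split; first by rewrite zo.
  by apply/negP => /st_ltP; rewrite /st_le xz.
have dio := connect_trans (st_across ix nix) (st_across xo nxo).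
have E1 := up_across (or_introl io) dio.
by exfalso; apply: (up_acyclic (connect0 _ i)); rewrite hi -to E1.
Qed.

Section OutEdges.
Hypothesis cross_out : forall a1 b1 a2 b2, dl a1 b1 -> dl b1 a2 -> dl a2 b2 ->
  tl a1 = tl a2 -> tl b1 = tl b2 -> tl a1 = tl b1.

Lemma st_noncrossing_tl : noncrossing setT st_lt tl.
Proof.
move=> a1 b1 a2 b2 _ _ _ _ ab1 ba ab2 ha hb.
have n2 : ~~ ge b1 a2.
  by apply: contraNN (st_up_irr ab1) => c; apply: (ge_same_tl (esym ha) c (st_lt_neq ba)).
have n3 : ~~ ge a2 b2.
  by apply: contraNN (st_up_irr ba) => c; apply: (ge_same_tl (esym hb) c (st_lt_neq ab2)).
have d2 := st_across ba n2; have d3 := st_across ab2 n3.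
case: (boolP (ge a1 b1)) => [c|n1]; last exact: (cross_out (st_across ab1 n1) d2 d3).
exfalso; have [i a1i /eqP ib1] := connect_last c (st_lt_neq ab1).
have ib1' : ge i b1 by apply: connect1; rewrite /up ib1.
have ib2 : ge i b2 by apply: connect1; rewrite /up ib1 hb.
have nia : ~~ ge i a2.
  apply/negP => ia; have [E1|nia] := eqVneq i a2.
    by case/negP: n3; rewrite -E1.
  have := leq_ltn_trans (leq_trans (up_lt hlt ia nia) _) (hlt i).
  by rewrite -ha (up_le hlt a1i) ltnn => /(_ isT).
have nai : ~~ ge a2 i by apply: contraNN n3 => c'; apply: connect_trans ib2.
case: (across_total nia nai) => [d|d].
  have E1 := up_across (or_introl ib2) (connect_trans d d3).
  by apply: (up_acyclic (connect0 _ i)); rewrite ib1 hb E1.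
have E1 := up_across (or_intror ib1') (connect_trans d2 d).
by apply: (up_acyclic (connect0 _ i)); rewrite ib1 E1.
Qed.

Lemma st_planar_order : planar_order setT tl hd st_lt.
Proof.
split=> [|i o _ _ io|v i o x _ _ _ hi to||].
- split=> [e|f e k _ _ _ ef fk|e f _ _].
  + by rewrite /st_lt eqxx.
  + have nek : e != k.
      by apply: contraTneq fk => E1; subst k; apply/negP => /andP[_]; apply/negP/st_ltP.
    by rewrite /st_lt nek; apply: st_le_trans (proj2 (andP ef)) (proj2 (andP fk)).
  + exact: st_lt_total.
- have ge_io : ge i o by apply: connect1; apply/eqP.
  rewrite /st_lt /st_le ge_io andbT; apply/eqP => E1; subst o.
  exact: (up_acyclic (connect0 _ i)).
- by case: (st_consecutive x hi to) => [[y [? ?]]|[y [? ?]]]; [left|right]; exists y; rewrite inE.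
- exact: st_noncrossing_hd.
- exact: st_noncrossing_tl.
Qed.
End OutEdges.

Lemma st_lt_e0 e : e != e0 -> st_lt e0 e.
Proof. by move=> ne; rewrite /st_lt eq_sym ne /st_le e0_across orbT. Qed.

End StDual.

Lemma orthogonal_flip (V E F : finType) (tl hd : E -> V) (lf rg : E -> F) :
  orthogonal tl hd lf rg -> orthogonal hd tl lf rg.
Proof.
move=> orth a b; apply: oppr_inj; rewrite oppr0 -sumrN -[RHS](orth a b).
by apply: eq_bigr => e _; rewrite -mulNr opprB.
Qed.

Lemma face_exact_flip (V E F : finType) (tl hd : E -> V) (lf rg : E -> F) :
  face_exact tl hd lf rg -> face_exact hd tl lf rg.
Proof.
move=> exct phi cons; apply: exct => a; apply: oppr_inj; rewrite oppr0 -sumrN -[RHS](cons a).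
by apply: eq_bigr => e _; rewrite -mulrN opprB.
Qed.

Theorem st_dual_planar_order (V E F : finType) (tl hd : E -> V) (lf rg : E -> F)
    (h : V -> nat) (e0 : E) :
  (forall e, (h (tl e) < h (hd e))%N) ->
  (forall e, tl e != tl e0 -> exists e', hd e' = tl e) ->
  (forall e, hd e != hd e0 -> exists e', tl e' = hd e) ->
  (forall e, hd e != tl e0) -> (forall e, tl e != hd e0) ->
  orthogonal tl hd lf rg -> face_exact tl hd lf rg ->
  exists2 lt : rel E, planar_order setT tl hd lt & forall e, e != e0 -> lt e0 e.
Proof.
move=> hlt has_in has_out src snk orth exct.
exists (st_lt tl hd lf rg e0); last exact: st_lt_e0 hlt has_in has_out src snk orth exct.
apply: (st_planar_order hlt has_in has_out src snk orth exct).
(* Reversing all edges with their faces kept leaves [across] unchanged, so the statement on tails is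
   the one on heads for the reversed graph, with the heights turned over. *)
apply: (@cross_in V E F hd tl lf rg (fun v => \max_u h u - h v)%N e0) => //.
- move=> e; have hN v : (h v <= \max_u h u)%N by apply: leq_bigmax.
  by have := hlt e; have := hN (hd e); lia.
- exact: orthogonal_flip.
- exact: face_exact_flip.
Qed.

(** * st-numberings of nonseparable edge sets *)

Section StNumbering.
Variables (V E : finType) (tl hd : E -> V).
Hypothesis loopless : forall e, tl e != hd e.

Definition is_end (e : E) (x : V) := (tl e == x) || (hd e == x).
Definition covers (A : {set E}) (x : V) := [exists e in A, is_end e x].

(** Two-connectedness phrased for edge sets: a single edge qualifies because it has no proper split,
    and a disconnected set does not. *)
Definition nonseparable (A : {set E}) := forall B : {set E},
  B \subset A -> B != set0 -> A :\: B != set0 ->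
  exists x y, [/\ x != y, covers B x, covers (A :\: B) x,
                  covers B y & covers (A :\: B) y].

Variable A : {set E}.
Definition adj x y := [exists e in A, is_end e x && is_end e y && (x != y)].

Lemma adj_sym : symmetric adj.
Proof.
by move=> x y; apply: eq_existsb => e; rewrite [_ && is_end e y]andbC eq_sym.
Qed.

(** A subsequence rather than a comparison of indices, so that it survives the insertion of an ear
    by transitivity. *)
Definition before (W : seq V) (a b : V) := subseq [:: a; b] W.

Lemma before_index W a b : uniq W -> before W a b -> (index a W < index b W)%N.
Proof.
elim: W => //= c W IH /andP[cW uW]; rewrite /before /=.
case: (eqVneq a c) => [_|nac].
  by rewrite sub1seq => bW; case: eqP => // E1; rewrite E1 bW in cW.
move=> ab; have bW : b \in W by apply: (mem_subseq ab); rewrite !inE eqxx orbT.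
by case: eqP => [E1|_]; [rewrite E1 bW in cW | rewrite ltnS; apply: IH].
Qed.

Lemma before_total W a b : a \in W -> b \in W -> a != b -> before W a b || before W b a.
Proof.
elim: W => //= c W IH; rewrite /before /= !inE.
case: (eqVneq a c) => [->|nac] /=; case: (eqVneq b c) => [->|nbc] //=; rewrite ?sub1seq.
- by move=> _ ->.
- by move=> ->; rewrite orbT.
Qed.

Variables (e0 : E).
Hypothesis (e0A : e0 \in A) (nonsepA : nonseparable A).
Let s := tl e0.
Let t := hd e0.

Definition st_seq (W : seq V) := [/\ uniq W, exists W', W = s :: rcons W' t,
  forall x, x \in W -> x != s -> exists2 y, adj x y & before W y x &
  forall x, x \in W -> x != t -> exists2 y, adj x y & before W x y].

Lemma st_seq_start : st_seq [:: s; t].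
Proof.
have ast : adj s t.
  by apply/exists_inP; exists e0; rewrite // /is_end !eqxx orbT loopless.
split=> /=.
- by rewrite inE loopless.
- by exists [::].
- move=> x; rewrite !inE => /orP[]/eqP->; first by rewrite eqxx.
  by exists s; [rewrite adj_sym | rewrite /before /= !eqxx].
- move=> x; rewrite !inE => /orP[]/eqP->; last by rewrite eqxx.
  by exists t; rewrite // /before /= !eqxx.
Qed.

(** The interior of the ear goes right after [x], hence before [y]: each new vertex then has its two
    neighbours on the ear on either side of it. *)
Lemma st_seq_ear W x y z : st_seq W -> before W x y ->
  uniq z -> {in z, forall u, u \notin W} -> path adj x (rcons z y) -> z != [::] ->
  exists2 W', st_seq W' & (size W < size W')%N.
Proof.
case=> uW [W0 WE] inW outW xy uz zW pz nz.
have xW : x \in W by apply: (mem_subseq xy); rewrite inE eqxx.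
have yW : y \in W by apply: (mem_subseq xy); rewrite !inE eqxx orbT.
case/splitPr: W / xW => p q in uW WE inW outW xy zW yW *.
have yq : y \in q.
  have := before_index uW xy; move: uW yW; rewrite cat_uniq mem_cat inE /=.
  case/and3P=> _ /norP[xp _] /andP[xq _].
  case: (boolP (y \in p)) => [yp _|_ /= /orP[/eqP->|//]]; last by rewrite ltnn.
  by rewrite !index_cat yp (negbTE xp) /= eqxx addn0 ltnNge index_size.
have WE' : exists W', p ++ x :: z ++ q = s :: rcons W' t.
  case/lastP: q WE yq {uW inW outW xy zW yW} => // q b WE _.
  case: p WE => [|a p] /= [-> WE].
    by move: WE => /rcons_inj[_ ->]; exists (z ++ q); rewrite rcons_cat.
  move: WE; rewrite -rcons_cons -rcons_cat => /rcons_inj[_ ->].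
  by exists (p ++ x :: z ++ q); rewrite -!rcons_cat -rcons_cons -rcons_cat.
pose W := p ++ x :: z ++ q.
have sW : subseq (p ++ x :: q) W.
  by apply: cat_subseq => //=; rewrite eqxx; apply: suffix_subseq.
have memW u : u \in W = (u \in p ++ x :: q) || (u \in z).
  by rewrite /W !(mem_cat, inE); do !case: (_ \in _); rewrite ?orbT ?orbF.
have zi a u b : rcons z y = a ++ u :: b -> u \in z ->
    (exists2 v, adj u v & before W v u) /\ (exists2 v, adj u v & before W u v).
  move=> zE uinz; have := pz; rewrite zE cat_path /= => /and3P[pa lu pb].
  have xzy : subseq (x :: rcons z y) W.
    apply: subseq_trans (suffix_subseq p _); rewrite /= eqxx -cats1.
    by apply: cat_subseq => //; rewrite sub1seq.
  split.
    exists (last x a); first by rewrite adj_sym.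
    apply: subseq_trans xzy; rewrite zE -cat_cons (lastI x a) cat_rcons.
    by apply: subseq_trans (suffix_subseq _ _); rewrite /= !eqxx sub0seq.
  case: b zE pb => [|v b] zE /=.
    move=> _; move: zE; rewrite cats1 => /rcons_inj[_ yu].
    have := zW _ uinz; by rewrite -yu yW.
  move=> /andP[uv _]; exists v => //.
  apply: subseq_trans xzy; rewrite zE.
  apply: subseq_trans (subseq_cons _ _); apply: subseq_trans (suffix_subseq _ _).
  by rewrite /= !eqxx sub0seq.
exists W; last first.
  by rewrite /W !size_cat /= size_cat ltn_add2l ltnS -[X in (X < _)%N]add0n ltn_add2r lt0n size_eq0.
split.
- have /perm_uniq -> : perm_eq W (z ++ (p ++ x :: q)).
    by rewrite /W -[x :: z ++ q]/([:: x] ++ (z ++ q)) -[x :: q]/([:: x] ++ q) perm_sym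
      perm_catCA perm_cat2l perm_catCA.
  by rewrite cat_uniq uz uW andbT /=; apply/hasPn => u uW'; apply: contraL uW'; apply: zW.
- exact: WE'.
- move=> u; rewrite memW => /orP[uW'|uz'] us.
    by have [v uv vu] := inW _ uW' us; exists v => //; apply: subseq_trans sW.
  have [a [b zE]] : exists a b, z = a ++ u :: b by case/splitPr: uz' => a b; exists a, b.
  by have [] := zi a u (rcons b y); rewrite ?zE ?rcons_cat // mem_cat inE eqxx orbT.
- move=> u; rewrite memW => /orP[uW'|uz'] us.
    by have [v uv vu] := outW _ uW' us; exists v => //; apply: subseq_trans sW.
  have [a [b zE]] : exists a b, z = a ++ u :: b by case/splitPr: uz' => a b; exists a, b.
  by have [] := zi a u (rcons b y); rewrite ?zE ?rcons_cat // mem_cat inE eqxx orbT.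
Qed.


(** Let [B] consist of the edges touching the component of [z] outside [W]. The edge [e0] has both
    ends on [W] and stays outside [B], so nonseparability gives two vertices common to [B] and its
    complement. They lie on [W] and are adjacent to the component, and a path through it is an
    ear. *)
Lemma st_seq_extend W z : st_seq W -> covers A z -> z \notin W ->
  exists2 W', st_seq W' & (size W < size W')%N.
Proof.
move=> stW zA zW; have [uW [W0 WE] _ _] := stW.
pose adjW x y := [&& adj x y, x \notin W & y \notin W].
have adjW_sym : symmetric adjW.
  by move=> x y; rewrite /adjW adj_sym; congr (_ && _); rewrite andbC.
have ZW u : connect adjW z u -> u \notin W.
  by move=> c; elim/connect_rind: u / c => // ? ? _ _ /and3P[].
pose B := [set e in A | [exists u, connect adjW z u && is_end e u]].
have BP e u : e \in A -> connect adjW z u -> is_end e u -> e \in B.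
  by move=> eA zu eu; rewrite inE eA; apply/existsP; exists u; rewrite zu.
have BA : B \subset A by apply/subsetP => e; rewrite inE => /andP[].
have B0 : B != set0.
  have /exists_inP[e eA ez] := zA; apply/set0Pn; exists e.
  exact: BP (connect0 _ _) ez.
have AB0 : A :\: B != set0.
  apply/set0Pn; exists e0; rewrite !inE e0A /= andbT.
  apply/existsP => -[u /andP[/ZW uW' /orP[]/eqP E1]]; move: uW'; rewrite -E1 WE.
    by rewrite inE eqxx.
  by rewrite inE mem_rcons inE eqxx orbT.
have touch x : covers B x -> covers (A :\: B) x ->
    x \in W /\ exists2 u, connect adjW z u & adj x u.
  move=> /exists_inP[e eB ex] /exists_inP[f /setDP[fA fB] fx].
  have xZ : ~~ connect adjW z x by apply: contraNN fB => zx; apply: BP zx fx.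
  move: eB; rewrite inE => /andP[eA /existsP[u /andP[zu eu]]].
  have xu : adj x u.
    apply/exists_inP; exists e => //; rewrite ex eu /=.
    by apply: contraNneq xZ => ->.
  split; last by exists u.
  apply: contraNT xZ => xW; apply: (connect_trans zu (connect1 _)).
  by apply/and3P; split; [rewrite adj_sym | apply: ZW | ].
have [x [y [nxy xB xAB yB yAB]]] := nonsepA BA B0 AB0.
have [xW [u zu xu]] := touch x xB xAB; have [yW [v zv yv]] := touch y yB yAB.
wlog bxy : x y u v {xB xAB yB yAB} nxy xW yW zu zv xu yv / before W x y.
  move=> wl; case/orP: (before_total xW yW nxy) => b.
    exact: (wl x y u v).
  by apply: (wl y x v u) => //; rewrite eq_sym.
have uv : connect adjW u v.
  by apply: connect_trans zv; rewrite (sym_connect_sym adjW_sym).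
have /connectP[p0 /shortenP[p pp up _] vE] := uv.
apply: (@st_seq_ear W x y (u :: p)) => //.
- move=> w; rewrite inE => /orP[/eqP->|wp]; first exact: ZW.
  apply: ZW; apply: (connect_trans zu).
  case/splitPr: wp pp => a b; rewrite cat_path => /andP[pa /= /andP[lw _]].
  by apply: connect_trans (connect1 lw); apply/connectP; exists a.
- rewrite /= xu rcons_path -vE adj_sym yv andbT.
  by apply: sub_path pp => ? ? /and3P[].
Qed.

Lemma st_numbering : exists h : V -> nat,
  [/\ forall e, e \in A -> h (tl e) != h (hd e),
      forall x, covers A x -> (h s <= h x <= h t)%N,
      forall x, covers A x -> x != s -> exists2 y, adj x y & (h y < h x)%N &
      forall x, covers A x -> x != t -> exists2 y, adj x y & (h x < h y)%N].
Proof.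
have [W stW cov] : exists2 W, st_seq W & forall x, covers A x -> x \in W.
  have [n] := ubnP (#|V| - size [:: s; t]); elim: n [:: s; t] st_seq_start => // n IH W stW lt.
  case: (pickP (fun x => covers A x && (x \notin W))) => [z /andP[zA zW]|none]; last first.
    by exists W => // x xA; have := none x; rewrite xA => /negbFE.
  have [W' stW' ltW] := st_seq_extend stW zA zW; apply: (IH W' stW').
  have [uW' _ _ _] := stW'; have := max_card (mem W'); rewrite (card_uniqP uW'); lia.
have [uW [W0 WE] inW outW] := stW.
exists (index^~ W); split=> [e eA|x /cov xW|x /cov xW /(inW _ xW)[y xy]|x /cov xW /(outW _ xW)[y xy]].
- have [tW hW] : tl e \in W /\ hd e \in W.
    by split; apply: cov; apply/exists_inP; exists e; rewrite // /is_end eqxx ?orbT.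
  by apply: contra_neq (loopless e) => /(congr1 (nth s W)); rewrite !nth_index.
- have -> : index s W = 0%N by rewrite WE /= eqxx.
  have := uW; rewrite {1}WE /= rcons_uniq => /and3P[sW tW _].
  move: xW; rewrite -index_mem WE /= size_rcons.
  have nst : (s == t) = false by apply/negbTE; exact: loopless.
  have -> : index t (rcons W0 t) = size W0.
    by rewrite -cats1 index_cat (negbTE tW) /= eqxx addn0.
  by rewrite nst ltnS.
- by exists y => //; apply: before_index.
- by exists y => //; apply: before_index.
Qed.

End StNumbering.

(** * Choice of directions, and orders rooted at a vertex *)

Definition flip (V E : finType) (b : pred E) (f g : E -> V) e := if b e then g e else f e.

Definition has_dual (V E : finType) (tl hd : E -> V) (A : {set E}) :=
  exists (F : finType) (lf rg : {e | e \in A} -> F),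
    orthogonal (tl \o val) (hd \o val) lf rg /\
    face_exact (tl \o val) (hd \o val) lf rg.

(** Reversing an edge exchanges its sides, so both factors of its term change sign. In contrast,
    [orthogonal_flip] keeps the sides and changes the sign of the whole sum. *)
Lemma orthogonal_flips (V E F : finType) (b : pred E) (tl hd : E -> V) (lf rg : E -> F) :
  orthogonal tl hd lf rg ->
  orthogonal (flip b tl hd) (flip b hd tl) (flip b lf rg) (flip b rg lf).
Proof.
move=> orth x y; rewrite -[RHS](orth x y); apply: eq_bigr => e _.
by rewrite /flip; case: (b e) => //; rewrite -[LHS]mulrNN !opprB.
Qed.

Lemma face_exact_flips (V E F : finType) (b : pred E) (tl hd : E -> V) (lf rg : E -> F) :
  face_exact tl hd lf rg ->
  face_exact (flip b tl hd) (flip b hd tl) (flip b lf rg) (flip b rg lf).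
Proof.
move=> exct phi cons.
have [|g gE] := exct (fun e => if b e then - phi e else phi e).
  move=> x; rewrite -[RHS](cons x); apply: eq_bigr => e _.
  by rewrite /flip; case: (b e) => //; rewrite -[LHS]mulrNN !opprB opprK.
by exists g => e; have := gE e; rewrite /flip; case: (b e) => // /(congr1 -%R); rewrite opprK opprB.
Qed.

(** The invariant of the gluing: [x] is a source, and an edge leaving [x] comes first. The last
    clause is conditional so that an edge set not touching [x] can also be rooted at [x]. *)
Definition sourced_order (V E : finType) (A : {set E}) (tl hd : E -> V) x lt :=
  [/\ planar_order A tl hd lt, {in A, forall e, hd e != x} &
      forall f, f \in A -> (exists2 e, e \in A & tl e = x) ->
        exists2 o, o \in A & tl o = x /\ (o == f) || lt o f].

Section Blocks.
Variables (V E : finType) (tl hd : E -> V).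
Hypothesis loopless : forall e, tl e != hd e.
Notation covers := (covers tl hd).
Notation incident := (is_end tl hd).

Definition orientable (A : {set E}) (x : V) :=
  exists b lt, sourced_order A (flip b tl hd) (flip b hd tl) x lt.

Lemma st_numbering_at (A : {set E}) e0 x : e0 \in A -> nonseparable tl hd A ->
  incident e0 x -> exists (h : V -> nat) (y : V),
  [/\ incident e0 y /\ x != y, {in A, forall e, h (tl e) != h (hd e)},
      forall z, covers A z -> (h x <= h z <= h y)%N,
      forall z, covers A z -> z != x -> exists2 u, adj tl hd A z u & (h u < h z)%N &
      forall z, covers A z -> z != y -> exists2 u, adj tl hd A z u & (h z < h u)%N].
Proof.
move=> e0A ns e0x; have [h [hn hb hlo hhi]] := st_numbering loopless e0A ns.
have [/eqP xE|nx] := boolP (tl e0 == x).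
  rewrite -xE; exists h, (hd e0); split=> //.
  by rewrite /incident eqxx orbT; split.
have /eqP xE : hd e0 == x by case/orP: e0x => // /(negP nx).
pose N := (\max_v h v)%N.
have hN v : (h v <= N)%N by apply: leq_bigmax.
rewrite -xE; exists (fun v => N - h v)%N, (tl e0); split=> [||z zA|z zA zn|z zA zn].
- by rewrite /incident eqxx; split => //; rewrite eq_sym.
- move=> e /hn; have := hN (tl e); have := hN (hd e); lia.
- have := hb z zA; have := hN z; have := hN (hd e0); lia.
- by have [u zu lt] := hhi z zA zn; exists u => //; have := hN u; lia.
- by have [u zu lt] := hlo z zA zn; exists u => //; have := hN z; lia.
Qed.

(** Every edge is directed upwards along a numbering with [x] lowest. Then [e0] runs from the source
    [x] to the sink and is the first edge of the resulting order. *)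
Lemma nonseparable_orientable (A : {set E}) e0 x : e0 \in A -> nonseparable tl hd A ->
  incident e0 x -> has_dual tl hd A -> orientable A x.
Proof.
move=> e0A ns e0x [F [lf [rg [orth exct]]]].
have [h [y [[e0y nxy] hn hb hlo hhi]]] := st_numbering_at e0A ns e0x.
pose b e := (h (hd e) < h (tl e))%N.
pose E' := {e | e \in A}; pose b' : pred E' := b \o val.
pose tl' := flip b tl hd; pose hd' := flip b hd tl.
have lt' e : e \in A -> (h (tl' e) < h (hd' e))%N.
  by move=> /hn; rewrite /tl' /hd' /flip /b; case: (ltngtP (h (tl e)) (h (hd e))).
have inc e u v : e \in A -> incident e u -> incident e v -> (h u < h v)%N ->
    tl' e = u /\ hd' e = v.
  rewrite /tl' /hd' /flip /b => eA /orP[] /eqP<- /orP[]/eqP<-; rewrite ?ltnn //.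
    by move=> lt; rewrite ltnNge (ltnW lt).
  by move=> ->.
have cov e : e \in A -> covers A (tl' e) /\ covers A (hd' e).
  move=> eA; split; apply/exists_inP; exists e; rewrite // /tl' /hd' /is_end /flip;
  by case: (b e); rewrite eqxx ?orbT.
have hxy : (h x < h y)%N.
  have xA : covers A x by apply/exists_inP; exists e0.
  have := hb x xA; have := hn e0 e0A; move: e0x e0y nxy.
  by move=> /orP[]/eqP<- /orP[]/eqP<-; rewrite ?eqxx //; lia.
have [e0t e0h] := inc e0 x y e0A e0x e0y hxy.
have stp : exists2 lt : rel E', planar_order setT (tl' \o val) (hd' \o val) lt &
    forall e, e != Sub e0 e0A -> lt (Sub e0 e0A) e.
  have EE : (tl' \o val = flip b' (tl \o val) (hd \o val)) /\
            (hd' \o val = flip b' (hd \o val) (tl \o val)).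
    by split.
  apply: (@st_dual_planar_order V E' F _ _ (flip b' lf rg) (flip b' rg lf) h (Sub e0 e0A)).
  - by move=> [e eA]; apply: lt'.
  - move=> [e eA] /=; rewrite e0t => /(hlo _ (proj1 (cov e eA)))[u].
    move=> /exists_inP[f fA /andP[/andP[fe fu] _]] hu.
    by exists (Sub f fA); have [_ ->] := inc f _ _ fA fu fe hu.
  - move=> [e eA] /=; rewrite e0h => /(hhi _ (proj2 (cov e eA)))[u].
    move=> /exists_inP[f fA /andP[/andP[fe fu] _]] hu.
    by exists (Sub f fA); have [-> _] := inc f _ _ fA fe fu hu.
  - move=> [e eA] /=; rewrite e0t; apply/eqP => E1.
    have := lt' e eA; have := hb _ (proj1 (cov e eA)); rewrite E1; lia.
  - move=> [e eA] /=; rewrite e0h; apply/eqP => E1.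
    have := lt' e eA; have := hb _ (proj2 (cov e eA)); rewrite E1; lia.
  - exact: orthogonal_flips.
  - exact: face_exact_flips.
have [lt [[irr tr tot] up cons nch nct] first] := stp.
pose ltA e f := if insub e is Some e' then
  if insub f is Some f' then lt e' f' else false else false.
have ltAE (e f : E') : ltA (val e) (val f) = lt e f.
  by rewrite /ltA !valK.
have inA e : e \in A -> exists e' : E', e = val e' by move=> eA; exists (Sub e eA).
exists b, ltA; rewrite -/tl' -/hd'; split; first split.
- split=> [e|f e k /inA[f' ->] /inA[e' ->] /inA[k' ->]|e f /inA[e' ->] /inA[f' ->]].
  + by rewrite /ltA; case: insubP.
  + by rewrite !ltAE; apply: tr.
  + by rewrite !ltAE => nef; apply: tot.
- move=> i o /inA[i' ->] /inA[o' ->]; rewrite ltAE; exact: up.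
- move=> v i o z /inA[i' ->] /inA[o' ->] /inA[z' ->] hi to.
  have [] := cons v i' o' z' => //.
    by case=> j [_ jv jz]; left; exists (val j); rewrite ltAE; split=> //; apply: valP.
  by case=> j [_ jv jz]; right; exists (val j); rewrite ltAE; split=> //; apply: valP.
- move=> a1 b1 a2 b2 /inA[a1' ->] /inA[b1' ->] /inA[a2' ->] /inA[b2' ->].
  by rewrite !ltAE; apply: nch.
- move=> a1 b1 a2 b2 /inA[a1' ->] /inA[b1' ->] /inA[a2' ->] /inA[b2' ->].
  by rewrite !ltAE; apply: nct.
- move=> e eA; apply/eqP => E1.
  have := lt' e eA; have := hb _ (proj1 (cov e eA)); rewrite E1; lia.
- move=> f fA _; exists e0 => //; split=> //.
  have [->//|nf] := eqVneq e0 f.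
  have [f' fE] := inA f fA; rewrite fE -[e0]/(val (Sub e0 e0A : E')) ltAE.
  by apply: first; apply: contraNneq nf; rewrite fE => ->.
Qed.

End Blocks.

(** * Gluing at a separating vertex *)

Lemma strict_total_rev (E : finType) (A : {set E}) (lt : rel E) :
  strict_total A lt -> strict_total A (fun x y => lt y x).
Proof.
case=> irr tr tot; split=> [x|y x z yA xA zA xy yz|x y xA yA nxy].
- exact: irr.
- exact: tr yz xy.
- by rewrite orbC tot.
Qed.

Lemma strict_total_min (E : finType) (A B : {set E}) (lt : rel E) :
  strict_total A lt -> B \subset A -> B != set0 ->
  exists2 m, m \in B & {in B, forall y, y != m -> lt m y}.
Proof.
move=> [irr tr tot] /subsetP BA /set0Pn[m0 m0B].
case: (@arg_minnP _ m0 [in B] (fun m => #|[set y in A | lt y m]|)) => // m mB min.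
exists m => // y yB nym; case/orP: (tot _ _ (BA _ yB) (BA _ mB) nym) => // ym.
have := min y yB; rewrite leqNgt; case/negP; apply: proper_card.
apply/properP; split.
  by apply/subsetP => z; rewrite !inE => /andP[zA zy]; rewrite zA (tr y) // BA.
by exists y; rewrite !inE ?ym ?irr ?andbF ?BA.
Qed.

Lemma strict_total_asym (E : finType) (A : {set E}) (lt : rel E) x y :
  strict_total A lt -> x \in A -> y \in A -> lt x y -> ~~ lt y x.
Proof.
by case=> irr tr tot xA yA xy; apply/negP => /(tr _ _ _ yA xA xA xy); rewrite irr.
Qed.

Section Glue.
Variables (V E : finType) (tl hd : E -> V) (A1 A2 : {set E}) (w x : V).
Variables (lt1 lt2 : rel E).
Hypothesis disj : [disjoint A1 & A2].
Hypothesis sep : forall e f v, e \in A1 -> f \in A2 ->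
  is_end tl hd e v -> is_end tl hd f v -> v = w.
Hypothesis xA1 : covers tl hd A2 x -> covers tl hd A1 x.
Hypothesis so1 : sourced_order A1 tl hd x lt1.
Hypothesis so2 : sourced_order A2 tl hd w lt2.

Let A := A1 :|: A2.

(* P selects the edges of A1 that precede the block A2. *)
Definition glue (P : pred E) : rel E := fun e f =>
  if e \in A1 then (if f \in A1 then lt1 e f else P e)
  else (if f \in A1 then ~~ P f else lt2 e f).

Let W2 := [exists o in A2, tl o == w].

Let incl e : is_end tl hd e (tl e). Proof. by rewrite /is_end eqxx. Qed.
Let inch e : is_end tl hd e (hd e). Proof. by rewrite /is_end eqxx orbT. Qed.

Section Pivot.
Variable P : pred E.
Hypothesis Pdown : {in A1 &, forall e f, lt1 e f -> P f -> P e}.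
Hypothesis Pin : W2 -> {in A1, forall i, hd i = w -> P i}.
Hypothesis Pbetween : forall v i o, i \in A1 -> o \in A1 -> hd i = v -> tl o = v ->
  ~~ W2 || (v != w) ->
  (exists i', [/\ i' \in A1, hd i' = v & ~~ P i']) \/
  (exists o', [/\ o' \in A1, tl o' = v & P o']).
Hypothesis Plast : W2 -> forall y i, y \in A1 -> i \in A1 -> hd i = w -> P y ->
  (exists i', [/\ i' \in A1, hd i' = w & ~~ lt1 i' y]) \/
  (exists o', [/\ o' \in A1, tl o' = w & ~~ lt1 y o']).
Hypothesis Pout : W2 -> forall o, o \in A1 -> tl o = w ->
  exists o', [/\ o' \in A1, tl o' = w, {in A1, forall b, P b -> lt1 b o'} &
    {in A1, forall b, ~~ P b -> tl b != w -> lt1 o' b}] /\ ~~ P o.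
Hypothesis Pfirst : ~~ W2 || (x != w) -> (exists2 e, e \in A1 & tl e = x) ->
  exists2 o, o \in A1 & tl o = x /\ P o.

(** The conditions on [P] describe a place for the block. It comes after the edges entering [w]
    ([Pin]), and no edge before it lies strictly between those entering and those leaving [w]
    ([Plast]). It comes before the edges leaving [w] ([Pout]), stays out of the gap between incoming
    and outgoing edges at other vertices ([Pbetween]), and leaves an edge out of [x] in front
    ([Pfirst]). *)
Lemma glue_sourced : sourced_order A tl hd x (glue P).
Proof.
have [[st1 up1 cons1 nch1 nct1] nx1 first1] := so1.
have [[st2 up2 cons2 nch2 nct2] nw2 first2] := so2.
have [irr1 tr1 tot1] := st1; have [irr2 tr2 tot2] := st2.
have A2F e : e \in A2 -> (e \in A1) = false.
  by move=> eA; apply: contraTF eA => eA1; rewrite (disjointFr disj eA1).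
have W2I o : o \in A2 -> tl o = w -> W2.
  by move=> oA ow; apply/exists_inP; exists o; rewrite ?ow.
have hd12 e f : e \in A1 -> f \in A2 -> hd e = hd f -> False.
  move=> eA fA ef; case/eqP: (nw2 f fA).
  by apply: (sep eA fA _ (inch f)); rewrite -ef.
have tl12 e f : e \in A1 -> f \in A2 -> tl e = tl f -> tl e = w.
  by move=> eA fA ef; apply: (sep eA fA (incl e)); rewrite ef.
have first2' f o : f \in A2 -> o \in A2 -> tl o = w ->
    exists2 o', o' \in A2 & tl o' = w /\ (o' == f) || lt2 o' f.
  by move=> fA oA ow; apply: first2 => //; exists o.
split; first split.
- split=> [e|f e k|e f].
  + by rewrite /glue; case: (e \in A1); rewrite ?irr1 ?irr2.
  + rewrite /A !inE /glue => /orP[] fA /orP[] eA /orP[] kA;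
      rewrite ?fA ?eA ?kA ?(A2F _ fA) ?(A2F _ eA) ?(A2F _ kA) //.
    * exact: tr1.
    * exact: Pdown.
    * by move=> nf fk; apply: contraNN nf; apply: Pdown fk.
    * by move=> /negP.
    * move=> Pe nk; have nek : e != k by apply: contraNneq nk => <-.
      case/orP: (tot1 _ _ eA kA nek) => // ke.
      by case/negP: nk; apply: Pdown ke Pe.
    * exact: tr2.
  + rewrite /A !inE /glue => /orP[] eA /orP[] fA nef;
      rewrite ?fA ?eA ?(A2F _ fA) ?(A2F _ eA) //.
    * exact: tot1.
    * exact: orbN.
    * by rewrite orNb.
    * exact: tot2.
- move=> i o; rewrite /A !inE /glue => /orP[] iA /orP[] oA io;
    rewrite ?iA ?oA ?(A2F _ iA) ?(A2F _ oA).
  + exact: up1.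
  + have iw : hd i = w by apply: (sep iA oA (inch i)); rewrite io.
    by apply: Pin => //; apply: (W2I o) => //; rewrite -io.
  + have ow : tl o = w by apply: (sep oA iA (incl o)); rewrite -io.
    by case/eqP: (nw2 i iA); rewrite io.
  + exact: up2.
- move=> v i o y; rewrite /A !inE => /orP[] iA /orP[] oA /orP[] yA hi to.
  + case: (cons1 v i o y iA oA yA hi to) => [[j [jA jv jy]]|[j [jA jv jy]]].
      by left; exists j; rewrite !inE jA /glue jA yA.
    by right; exists j; rewrite !inE jA /glue jA yA.
  + have [/andP[w2 /eqP vw]|] := boolP (W2 && (v == w)).
      have /exists_inP[o2 o2A /eqP o2w] := w2.
      have [o' o'A [o'w o'y]] := first2' y o2 yA o2A o2w.
      right; exists o'; rewrite !inE o'A orbT /glue (A2F _ yA) (A2F _ o'A) vw; split=> //.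
      case/orP: o'y => [/eqP->|o'y]; first by rewrite irr2.
      exact: strict_total_asym st2 _ _ o'y.
    rewrite negb_and => /(Pbetween iA oA hi to) [[j [jA jv jP]]|[j [jA jv jP]]].
      by left; exists j; rewrite !inE jA /glue jA (A2F _ yA).
    by right; exists j; rewrite !inE jA /glue jA (A2F _ yA) negbK.
  + have vw : v = w by apply: (sep iA oA); rewrite -?hi -?to ?inch ?hi -?to.
    have w2 : W2 by apply: (W2I o) => //; rewrite to.
    have [Py|nPy] := boolP (P y); last first.
      by right; exists o; rewrite !inE oA orbT /glue yA (A2F _ oA) to vw.
    have iw : hd i = w by rewrite hi.
    case: (Plast w2 yA iA iw Py) => [[j [jA jv jy]]|[j [jA jv jy]]].
      by left; exists j; rewrite !inE jA /glue jA yA vw.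
    by right; exists j; rewrite !inE jA /glue jA yA vw.
  + have vw : v = w by apply: (sep iA oA); rewrite -?hi -?to ?inch ?hi -?to.
    have ow : tl o = w by rewrite to.
    have [o' o'A [o'w o'y]] := first2' y o yA oA ow.
    right; exists o'; rewrite !inE o'A orbT /glue (A2F _ yA) (A2F _ o'A) vw; split=> //.
    case/orP: o'y => [/eqP->|o'y]; first by rewrite irr2.
    exact: strict_total_asym st2 _ _ o'y.
  + have vw : v = w by apply: (sep oA iA); rewrite -?to ?incl // to -hi inch.
    by case/eqP: (nw2 i iA); rewrite hi.
  + have vw : v = w by apply: (sep oA iA); rewrite -?to ?incl // to -hi inch.
    by case/eqP: (nw2 i iA); rewrite hi.
  + have [Py|nPy] := boolP (P y).
      by left; exists i; rewrite !inE iA orbT /glue (A2F _ iA) yA Py.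
    by right; exists o; rewrite !inE oA orbT /glue (A2F _ oA) yA.
  + case: (cons2 v i o y iA oA yA hi to) => [[j [jA jv jy]]|[j [jA jv jy]]].
      by left; exists j; rewrite !inE jA orbT /glue (A2F _ jA) (A2F _ yA).
    by right; exists j; rewrite !inE jA orbT /glue (A2F _ jA) (A2F _ yA).
(* No edge of [A2] enters [w], so a head class lies in one part; and the block is an interval, so
   classes of different parts do not cross. *)
- move=> a1 b1 a2 b2; rewrite /A !inE /glue => /orP[] a1A /orP[] b1A /orP[] a2A /orP[] b2A;
    rewrite ?a1A ?b1A ?a2A ?b2A ?(A2F _ a1A) ?(A2F _ b1A) ?(A2F _ a2A) ?(A2F _ b2A) //;
    try by move=> _ _ _ ha hb; exfalso;
      first [exact: (hd12 a1 a2) | exact: (hd12 b1 b2)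
            |exact: (hd12 a2 a1 _ _ (esym ha)) | exact: (hd12 b2 b1 _ _ (esym hb))].
  + exact: nch1.
  + by move=> _ /negP na /na.
  + by move=> /negP nb /nb.
  + exact: nch2.
(* Only the tail class of [w] meets both parts. Against edges of [A1] with another tail, the edge
   from [Pout] stands in for the block; against edges of [A2], the first edge of the block leaving
   [w] stands in for the edges of [A1]. *)
- move=> a1 b1 a2 b2; rewrite /A !inE /glue => /orP[] a1A /orP[] b1A /orP[] a2A /orP[] b2A;
    rewrite ?a1A ?b1A ?a2A ?b2A ?(A2F _ a1A) ?(A2F _ b1A) ?(A2F _ a2A) ?(A2F _ b2A) //;
    move=> ab1 ba ab2 ha hb.
  + exact: (nct1 a1 b1 a2 b2).
  + have bw : tl b1 = w by exact: (tl12 b1 b2).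
    have w2 : W2 by apply: (W2I b2); rewrite // -hb.
    have [_ [_ /negP nb1]] := Pout w2 b1A bw; case: nb1; exact: Pdown ba ab2.
  + have aw : tl a1 = w by exact: (tl12 a1 a2).
    have w2 : W2 by apply: (W2I a2); rewrite // -ha.
    have [bw|bw] := eqVneq (tl b2) w; first by rewrite hb bw.
    have [o [[oA ow lo hi] _]] := Pout w2 a1A aw.
    by apply: (nct1 a1 b1 o b2); rewrite ?ow //; [apply: lo | apply: hi].
  + by rewrite (tl12 a1 a2) // (tl12 b1 b2).
  + have bw : tl b2 = w by exact: (tl12 b2 b1).
    have w2 : W2 by apply: (W2I b1); rewrite // hb.
    have [aw|aw] := eqVneq (tl a2) w; first by rewrite ha aw hb bw.
    have [o [[oA ow lo hi] _]] := Pout w2 b2A bw.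
    rewrite hb bw -ow; apply: (nct1 a1 o a2 b2); rewrite ?ow //; [exact: lo | exact: hi].
  + by case/negP: ba.
  + by rewrite (tl12 a1 a2) // hb (tl12 b2 b1).
  + have aw : tl a1 = w by exact: (tl12 a1 a2).
    have [o oA [ow /orP[/eqP ob|ob]]] := first2' b1 a2 b1A a2A (etrans (esym ha) aw).
      by rewrite aw -ow ob.
    by rewrite aw -ow; apply: (nct2 o b1 a2 b2); rewrite // ow -ha.
  + have aw : tl a2 = w by exact: (tl12 a2 a1).
    have w2 : W2 by apply: (W2I a1); rewrite // ha.
    have [bw|bw] := eqVneq (tl b1) w; first by rewrite ha aw.
    have [o [[oA ow lo hi] _]] := Pout w2 a2A aw.
    rewrite ha aw -ow; apply: (nct1 o b1 a2 b2); rewrite ?ow //; exact: hi.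
  + by rewrite ha (tl12 a2 a1) // (tl12 b1 b2).
  + by case/negP: ab1.
  + by case/negP: ab1.
  + by rewrite ha (tl12 a2 a1) // hb (tl12 b2 b1).
  + by case/negP: ba.
  + have bw : tl b1 = w by rewrite hb; exact: (tl12 b2 b1).
    have [o oA [ow /orP[/eqP oa|oa]]] := first2' a1 b1 a1A b1A bw.
      by rewrite bw -ow oa.
    by rewrite bw -ow; apply/esym/(nct2 o a1 b1 a2); rewrite // ow bw.
  + exact: (nct2 a1 b1 a2 b2).
- move=> e; rewrite /A !inE => /orP[] eA; first exact: nx1.
  apply/eqP => ex; have : covers tl hd A2 x by apply/exists_inP; exists e; rewrite -?ex.
  move=> /xA1/exists_inP[f fA fx]; case/eqP: (nw2 e eA); rewrite ex.
  by apply: (sep fA eA fx); rewrite -ex.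
- move=> f fA [e eA ex].
  have [e1 e1A e1x] : exists2 e1, e1 \in A1 & tl e1 = x.
    move: eA; rewrite !inE => /orP[eA|eA]; first by exists e.
    have : covers tl hd A2 x by apply/exists_inP; exists e; rewrite -?ex.
    move=> /xA1/exists_inP[e1 e1A /orP[]/eqP e1x]; exists e1 => //.
    by case/eqP: (nx1 e1 e1A).
  move: fA; rewrite /A inE => /orP[] fA.
    have [o oA [ox of_]] := first1 f fA (ex_intro2 _ _ e1 e1A e1x).
    by exists o; rewrite /glue ?inE oA ?fA.
  have [/andP[w2 /eqP xw]|] := boolP (W2 && (x == w)).
    have /exists_inP[o2 o2A /eqP o2w] := w2.
    have [o oA [ow of_]] := first2' f o2 fA o2A o2w.
    by exists o; rewrite /glue ?inE ?oA ?orbT ?(A2F _ oA) ?(A2F _ fA) ?xw.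
  rewrite negb_and => /Pfirst/(_ (ex_intro2 _ _ e1 e1A e1x))[o oA [ox Po]].
  by exists o; rewrite /glue ?inE ?oA ?(A2F _ fA) ?Po ?orbT.
Qed.
End Pivot.

(** The block goes just before the first edge of [A1] leaving [w] or, if none leaves, just after the
    last one entering. If one of the parts does not touch [w], the block goes to the end; failure of
    [W2] means this for [A2], since no edge of [A2] enters [w]. *)
Lemma glue_exists : exists lt, sourced_order A tl hd x lt.
Proof.
have [[st1 up1 cons1 nch1 nct1] nx1 first1] := so1; have [irr1 tr1 tot1] := st1.
pose O1 := [set o in A1 | tl o == w]; pose I1 := [set i in A1 | hd i == w].
have O1P o : o \in A1 -> tl o = w -> o \in O1 by move=> oA ow; rewrite inE oA ow /=.
have I1P i : i \in A1 -> hd i = w -> i \in I1 by move=> iA iw; rewrite inE iA iw /=.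
have [w2|nw2] := boolP W2; last first.
  have W2F : W2 -> False by apply/negP.
  exists (glue predT); apply: glue_sourced => //.
  - by move=> v i o iA oA hi to _; right; exists o.
  - by move=> _ [e eA ex]; exists e.
have [O0|O0] := eqVneq O1 set0; last first.
  have [|m] := @strict_total_min E A1 O1 lt1 st1 _ O0.
    by apply/subsetP => o; rewrite inE => /andP[].
  rewrite inE => /andP[mA /eqP mw] min.
  exists (glue (lt1^~ m)); apply: glue_sourced.
  - by move=> e f eA fA; apply: tr1.
  - by move=> _ i iA iw; apply: up1; rewrite // mw.
  - rewrite w2 => v i o iA oA hi to vw.
    case: (cons1 v i o m iA oA mA hi to) => [|[j [jA jv jm]]]; first by left.
    right; exists j; split=> //; have njm : j != m by apply: contraNneq vw => E1; rewrite -jv E1 mw.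
    by case/orP: (tot1 _ _ jA mA njm) => // mj; rewrite mj in jm.
  - by move=> _ y i yA iA iw _; apply: (cons1 w i m).
  - move=> _ o oA ow; exists m; split; first split=> // b bA nb bw.
      have nbm : m != b by apply: contraNneq bw => <-; rewrite mw.
      by case/orP: (tot1 _ _ mA bA nbm) => // bm; rewrite bm in nb.
    have [->|om] := eqVneq o m; first by rewrite irr1.
    by apply: (strict_total_asym st1) => //; apply: min; rewrite // O1P.
  - rewrite w2 /= => xw /(first1 m mA)[o oA [ox /orP[/eqP om|om]]]; last by exists o.
    by case/eqP: xw; rewrite -ox om mw.
have O0' o : o \in A1 -> tl o = w -> False by move=> oA /(O1P o oA); rewrite O0 inE.
have [I0|I0] := eqVneq I1 set0.
  have I0' i : i \in A1 -> hd i = w -> False by move=> iA /(I1P i iA); rewrite I0 inE.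
  exists (glue predT); apply: glue_sourced => //.
  - by move=> v i o iA oA hi to _; right; exists o.
  - by move=> _ y i yA iA /(I0' i iA).
  - by move=> _ o oA /(O0' o oA).
  - by move=> _ [e eA ex]; exists e.
have [|m] := @strict_total_min E A1 I1 _ (strict_total_rev st1) _ I0.
  by apply/subsetP => o; rewrite inE => /andP[].
rewrite inE => /andP[mA /eqP mw] max.
exists (glue (fun e => (e == m) || lt1 e m)); apply: glue_sourced.
- by move=> e f eA fA ef /orP[/eqP<-|fm]; rewrite ?ef ?orbT // (tr1 f) ?orbT.
- by move=> _ i iA iw; have [//|im] := eqVneq i m; rewrite max // I1P.
- rewrite w2 => v i o iA oA hi to vw.
  case: (cons1 v i o m iA oA mA hi to) => -[j [jA jv jm]].
    by left; exists j; rewrite negb_or jm andbT; split=> //; apply: contraNneq vw => E1; rewrite -jv E1 mw.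
  right; exists j; split=> //; have [//|njm] := eqVneq j m.
  by case/orP: (tot1 _ _ jA mA njm) => // mj; rewrite mj in jm.
- move=> _ y i yA iA iw /orP[/eqP->|ym]; left; exists m; rewrite ?irr1; split=> //.
  exact: (strict_total_asym st1).
- by move=> _ o oA /(O0' o oA).
- by rewrite w2 /= => xw /(first1 m mA)[o oA [ox om]]; exists o.
Qed.
End Glue.

(** * Induction over separating vertices *)

Section Orientable.
Variables (V E : finType) (tl hd : E -> V).
Hypothesis loopless : forall e, tl e != hd e.
Hypothesis dualA : forall A : {set E}, has_dual tl hd A.

Lemma sourced_order_ext (A : {set E}) (tl' hd' tl2 hd2 : E -> V) x lt :
  {in A, tl' =1 tl2} -> {in A, hd' =1 hd2} ->
  sourced_order A tl' hd' x lt -> sourced_order A tl2 hd2 x lt.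
Proof.
move=> tE hE [[st up cons nch nct] nx first].
split; first split=> //.
- by move=> i o iA oA; rewrite -hE // -tE //; apply: up.
- move=> v i o y iA oA yA; rewrite -hE // -tE // => hi to.
  have [[j [jA jv jy]]|[j [jA jv jy]]] := cons v i o y iA oA yA hi to.
    by left; exists j; rewrite -hE.
  by right; exists j; rewrite -tE.
- by move=> a1 b1 a2 b2 *; rewrite -!hE //; apply: (nch a1 b1 a2 b2); rewrite // !hE.
- by move=> a1 b1 a2 b2 *; rewrite -!tE //; apply: (nct a1 b1 a2 b2); rewrite // !tE.
- by move=> e eA; rewrite -hE // nx.
- move=> f fA [e eA ex]; have [|o oA [ox of_]] := first f fA.
    by exists e; rewrite // tE.
  by exists o; rewrite // -tE.
Qed.

Lemma is_end_flip b e v : is_end (flip b tl hd) (flip b hd tl) e v = is_end tl hd e v.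
Proof. by rewrite /is_end /flip; case: (b e); rewrite // orbC. Qed.

Lemma orientable_glue (A1 A2 : {set E}) w x : [disjoint A1 & A2] ->
  (forall v, covers tl hd A1 v -> covers tl hd A2 v -> v = w) ->
  (covers tl hd A2 x -> covers tl hd A1 x) ->
  orientable tl hd A1 x -> orientable tl hd A2 w -> orientable tl hd (A1 :|: A2) x.
Proof.
move=> disj sep xA [b1 [lt1 so1]] [b2 [lt2 so2]].
pose b e := if e \in A1 then b1 e else b2 e.
have bE1 f g : {in A1, flip b1 f g =1 flip b f g} by move=> e eA; rewrite /flip /b eA.
have bE2 f g : {in A2, flip b2 f g =1 flip b f g}.
  by move=> e eA; rewrite /flip /b (disjointFl disj eA).
exists b; apply: (@glue_exists _ _ _ _ _ _ w x lt1 lt2 disj).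
- move=> e f v eA fA; rewrite !is_end_flip => ev fv.
  by apply: sep; apply/exists_inP; [exists e | exists f].
- move=> /exists_inP[e eA]; rewrite is_end_flip => ex.
  have /xA/exists_inP[f fA fx] : covers tl hd A2 x by apply/exists_inP; exists e.
  by apply/exists_inP; exists f; rewrite // is_end_flip.
- exact: sourced_order_ext so1.
- exact: sourced_order_ext so2.
Qed.

Lemma orientable_set0 x : orientable tl hd set0 x.
Proof.
exists pred0, (fun _ _ => false); split; first split; first split.
all: repeat (intro; try match goal with H : is_true (in_mem _ _) |- _ => by rewrite inE in H end).
by [].
Qed.

Theorem all_orientable (A : {set E}) x : orientable tl hd A x.
Proof.
have [n] := ubnP #|A|; elim: n A x => // n IH A x lt.
have [A0|/set0Pn[e eA]] := eqVneq A set0.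
  by rewrite A0; apply: orientable_set0.
pose common B v := covers tl hd B v && covers tl hd (A :\: B) v.
pose separates (B : {set E}) := [&& B \subset A, B != set0, A :\: B != set0 &
  ~~ [exists u, exists v, [&& u != v, common B u & common B v]]].
have [B|none] := pickP separates; last first.
  have ns : nonseparable tl hd A.
    move=> B BA B0 AB0; have := none B; rewrite /separates BA B0 AB0 /= => /negbFE.
    move=> /existsP[u /existsP[v /and3P[uv /andP[? ?] /andP[? ?]]]].
    by exists u, v.
  have [/exists_inP[e0 e0A e0x]|xA] := boolP (covers tl hd A x).
    exact: (nonseparable_orientable loopless e0A).
  (* No edge touches [x], so both conditions on [x] hold vacuously and the order may be rooted at
     any end of an edge. *)
  have [|b [lt' [po _ _]]] := nonseparable_orientable loopless eA ns (_ : is_end tl hd e (tl e)) (dualA A).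
    by rewrite /is_end eqxx.
  have nx f : f \in A -> ~~ is_end tl hd f x.
    by move=> fA; apply: contraNN xA => fx; apply/exists_inP; exists f.
  exists b, lt'; split=> // [f fA|f _ [g gA gx]]; first apply: contraNneq (nx f fA) => fx;
    last (exfalso; apply/negP: (nx g gA)).
    by rewrite -(is_end_flip b) /is_end fx eqxx orbT.
  by rewrite -(is_end_flip b) /is_end gx eqxx.
case/and4P=> BA B0 AB0 /existsPn sepB.
have [w sep] : exists w, forall v, covers tl hd B v -> covers tl hd (A :\: B) v -> v = w.
  case: (pickP (common B)) => [w cw|none]; last first.
    by exists x => v vB vAB; have := none v; rewrite /common vB vAB.
  exists w => v vB vAB; apply/eqP; apply: contraNT (sepB v) => vw.
  by apply/existsP; exists w; rewrite vw cw /common vB vAB.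
have disj : [disjoint B & A :\: B] by rewrite -setI_eq0 setIDA setIC -setIDA setDv setI0.
have AE : B :|: (A :\: B) = A by rewrite -[in RHS](setID A B) (setIidPr BA).
have cardA : (#|B| + #|A :\: B| = #|A|)%N by rewrite -[in RHS](cardsID B A) (setIidPr BA).
move: B0 AB0; rewrite -!card_gt0 => B0 AB0.
(* The part kept as the base must touch [x] if any part does; the other one is rooted at the common
   vertex [w] and inserted. *)
have [xAB|xAB] := boolP (covers tl hd (A :\: B) x ==> covers tl hd B x).
  rewrite -AE; apply: (orientable_glue disj sep (implyP xAB)); apply: IH; lia.
rewrite -AE setUC; apply: (@orientable_glue _ _ w); last 2 first.
- apply: IH; lia.
- apply: IH; lia.
- by rewrite disjoint_sym.
- by move=> v vAB vB; apply: sep.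
- by move: xAB; rewrite negb_imply => /andP[].
Qed.
End Orientable.

(** * Duals of lattice minors *)

Definition latpoint := (nat * nat)%type.

Definition lattice_step : rel latpoint := fun x y =>
  [|| y == (x.1.+1, x.2), y == (x.1, x.2.+1), x == (y.1.+1, y.2) | x == (y.1, y.2.+1)].

Section Lattice.
Variable M : nat.
Let N := M.+1.
Notation I := 'I_M.+1.

(* The edge [(true, (i, j))] is horizontal and [(false, (i, j))] is vertical;
   both start at [(i, j)].  The face [(i, j)] has [(i, j)] as lower left corner. *)
Definition ledge : finType := (bool * (I * I))%type.
Definition ltl (e : ledge) : latpoint := (val e.2.1, val e.2.2).
Definition lhd (e : ledge) : latpoint :=
  if e.1 then (e.2.1.+1, val e.2.2) else (val e.2.1, e.2.2.+1).
(** The predecessor stops at 0, so a horizontal edge of row 0 or a vertical edge of column 0 has the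
    same face on both sides; [lattice_exact] assumes that the flow vanishes there. *)
Definition llf (e : ledge) : I * I :=
  if e.1 then e.2 else (inord e.2.1.-1, e.2.2).
Definition lrg (e : ledge) : I * I :=
  if e.1 then (e.2.1, inord e.2.2.-1) else e.2.

Lemma sum_ledge (f : ledge -> int) :
  \sum_e f e = \sum_(i < N) \sum_(j < N) (f (true, (i, j)) + f (false, (i, j))).
Proof.
rewrite pair_bigA /=; have -> : \sum_e f e = \sum_(b : bool) \sum_(x : I * I) f (b, x).
  by rewrite pair_bigA; apply: eq_bigr => -[b x].
by rewrite big_bool /= -big_split; apply: eq_bigr => -[i j].
Qed.

Lemma abel_sum (a c : nat -> int) : a 0%N = 0 -> a N = 0 ->
  \sum_(i < N) (a i.+1 - a i) * c i = \sum_(i < N) a i * (c i.-1 - c i).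
Proof.
move=> a0 aN; under eq_bigr do rewrite mulrBl.
under [RHS]eq_bigr do rewrite mulrBr.
rewrite !sumrB; congr (_ - _); rewrite big_ord_recr /= [in RHS]big_ord_recl /=.
by rewrite a0 -/N aN !mul0r addr0 add0r.
Qed.

(** Lattice edges may end at coordinate [N], one step beyond the index set. Vanishing there and at 0
    removes the boundary terms from the summation by parts. *)
Definition interior (a : nat -> nat -> int) :=
  forall i j, [|| i == 0, i == N, j == 0 | j == N]%N -> a i j = 0.

Lemma lattice_boundary (a h v : nat -> nat -> int) : interior a ->
  \sum_(i < N) \sum_(j < N) ((a i.+1 j - a i j) * h i j + (a i j.+1 - a i j) * v i j) =
  \sum_(i < N) \sum_(j < N) a i j * (h i.-1 j - h i j + (v i j.-1 - v i j)).
Proof.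
move=> ai; under eq_bigr do rewrite big_split.
rewrite big_split /= [X in X + _ = _]exchange_big /=.
under [X in X + _ = _]eq_bigr => j _.
  rewrite (abel_sum (a := a^~ j) (h^~ j)) /=; [|by apply: ai; rewrite eqxx ?orbT..].
  over.
under [X in _ + X = _]eq_bigr => i _.
  rewrite (abel_sum (a := a i) (v i)) /=; [|by apply: ai; rewrite eqxx ?orbT..].
  over.
rewrite [X in X + _ = _]exchange_big -big_split; apply: eq_bigr => i _.
by rewrite -big_split; apply: eq_bigr => j _; rewrite /= -mulrDr.
Qed.

Lemma lattice_orthogonal (a : nat -> nat -> int) (b : I * I -> int) : interior a ->
  \sum_e (a (lhd e).1 (lhd e).2 - a (ltl e).1 (ltl e).2) * (b (llf e) - b (lrg e)) = 0.
Proof.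
move=> ai; pose B i j := b (inord i, inord j).
rewrite sum_ledge /=.
transitivity (\sum_(i < N) \sum_(j < N) ((a i.+1 j - a i j) * (B i j - B i j.-1) +
   (a i j.+1 - a i j) * (B i.-1 j - B i j))).
  apply: eq_bigr => i _; apply: eq_bigr => j _.
  by rewrite /B /llf /lrg /= !inord_val.
rewrite (lattice_boundary (fun i j => B i j - B i j.-1) (fun i j => B i.-1 j - B i j)) //.
rewrite big1 // => i _; rewrite big1 // => j _; ring.
Qed.

(** A discrete Poincare lemma. The potential [G] adds up the horizontal flow in a column from below;
    conservation at interior points propagates the correct vertical differences upwards from row
    0. *)
Lemma lattice_exact (phi : ledge -> int) :
  (forall a, interior a ->
    \sum_e phi e * (a (lhd e).1 (lhd e).2 - a (ltl e).1 (ltl e).2) = 0) ->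
  (forall e, ((ltl e).1 == 0) || ((ltl e).2 == 0) -> phi e = 0)%N ->
  exists g : I * I -> int, forall e, phi e = g (llf e) - g (lrg e).
Proof.
move=> cons border; pose h i j := phi (true, (inord i, inord j)).
pose v i j := phi (false, (inord i, inord j)).
have bal i j : (0 < i < N)%N -> (0 < j < N)%N ->
    h i.-1 j - h i j + (v i j.-1 - v i j) = 0.
  move=> iN jN; pose a (i' j' : nat) : int := ((i' == i) && (j' == j))%:R.
  have ai : interior a.
    move=> i' j' b; rewrite /a; case: (eqVneq i' i) b => [->|//]; case: (eqVneq j' j) => [->|//].
    by rewrite !eqn0Ngt; lia.
  rewrite -[RHS](cons a ai) sum_ledge.
  transitivity (\sum_(i < N) \sum_(j < N) ((a i.+1 j - a i j) * h i j + (a i j.+1 - a i j) * v i j)).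
    rewrite lattice_boundary //.
    have [_ iN'] := andP iN; have [_ jN'] := andP jN.
    rewrite (bigD1 (Ordinal iN')) //= (bigD1 (Ordinal jN')) //= /a !eqxx mul1r.
    rewrite big1 => [|j' nj]; last first.
      by rewrite (_ : (val j' == j) = false) ?andbF ?mul0r //; apply: negbTE nj.
    rewrite big1 ?addr0 // => i' ni; rewrite big1 // => j' _.
    by rewrite (_ : (val i' == i) = false) ?mul0r //; apply: negbTE ni.
  apply: eq_bigr => i' _; apply: eq_bigr => j' _.
  by rewrite /h /v /= !inord_val mulrC; congr (_ + _); rewrite mulrC.
pose G i j := \sum_(k < j.+1) h i k.
have hborder (i j : nat) : (i == 0)%N || (j == 0)%N -> (i < N)%N -> (j < N)%N -> h i j = 0 /\ v i j = 0.
  by move=> ij iN jN; split; apply: border; rewrite /= !inordK.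
have Gh i j : (j < N)%N -> (i < N)%N -> G i j - G i j.-1 = h i j.
  case: j => [|j] jN iN /=; last by rewrite /G [X in X - _]big_ord_recr /= addrAC subrr add0r.
  by rewrite subrr (hborder i 0%N _ iN jN).1 ?orbT.
have Gv i j : (i < N)%N -> (j < N)%N -> G i.-1 j - G i j = v i j.
  case: i => [|i] iN jN /=; first by rewrite subrr (hborder 0%N j _ iN jN).2.
  elim: j jN => [|j IH] jN.
    rewrite /G !big_ord1 (hborder i 0%N _ _ jN).1 ?orbT ?(ltnW iN) //.
    by rewrite (hborder i.+1 0%N _ iN jN).1 ?(hborder i.+1 0%N _ iN jN).2 ?orbT.
  have := bal i.+1 j.+1 iN jN; have := IH (ltnW jN); rewrite /G /=.
  rewrite ![\sum_(k < j.+2) _]big_ord_recr /=.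
  by move=> <- E1; apply/eqP; rewrite -subr_eq0 -[X in _ == X]E1; apply/eqP; ring.
exists (fun f : I * I => G f.1 f.2) => -[[] [i j]]; rewrite /llf /lrg /=.
  by rewrite inordK ?(leq_ltn_trans (leq_pred _)) // Gh // /h !inord_val.
by rewrite inordK ?(leq_ltn_trans (leq_pred _)) // Gv // /v !inord_val.
Qed.

(** * Passing the dual of the lattice to a minor *)

Section Minor.
Variables (V E : finType) (tl hd : E -> V).
Variables (p : latpoint -> option V) (iota : E -> ledge).
Hypothesis loopless : forall e, tl e != hd e.
Hypothesis p_interior : forall x v, p x = Some v -> (0 < x.1 < N)%N && (0 < x.2 < N)%N.
Hypothesis iota_inj : injective iota.
Hypothesis iota_tl : forall e, p (ltl (iota e)) = Some (tl e).
Hypothesis iota_hd : forall e, p (lhd (iota e)) = Some (hd e).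
Hypothesis branch_connected : forall v x y, p x = Some v -> p y = Some v ->
  exists q, [/\ path lattice_step x q, last x q = y &
    {in q, forall z, p z = Some v}].

Definition kept : {set ledge} := [set iota e | e in setT].
Definition contracted : {set ledge} :=
  [set e | (p (ltl e) != None) && (p (ltl e) == p (lhd e))].
Definition deleted : {set ledge} := ~: (kept :|: contracted).

Lemma keptP e : iota e \in kept. Proof. exact: imset_f. Qed.

Lemma kept_not_contracted e : iota e \notin contracted.
Proof.
rewrite inE iota_tl iota_hd /=; apply: contra (loopless e) => /eqP[->]; exact: eqxx.
Qed.

Lemma route v x y : p x = Some v -> p y = Some v -> exists psi : ledge -> int,
  (forall e, e \notin contracted -> psi e = 0) /\
  forall a : latpoint -> int, \sum_e psi e * (a (lhd e) - a (ltl e)) = a y - a x.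
Proof.
move=> px py; have [q [xq <- qv]] := branch_connected px py.
elim: q x px xq qv {py y} => [|z q IH] x px /=.
  exists (fun=> 0); split=> // a; rewrite subrr big1 // => e _; exact: mul0r.
case/andP=> xz zq qv; have pz : p z = Some v by apply: qv; rewrite inE eqxx.
have [|psi [psi0 psia]] := IH z pz zq; first by move=> y yq; apply: qv; rewrite inE yq orbT.
have [e [c [ec ce]]] : exists e c, e \in contracted /\
    forall a : latpoint -> int, c * (a (lhd e) - a (ltl e)) = a z - a x.
  have := p_interior px; have := p_interior pz.
  move=> /andP[/andP[_ z1] /andP[_ z2]] /andP[/andP[_ x1] /andP[_ x2]].
  case/or4P: xz => /eqP E1.
  - exists (true, (Ordinal x1, Ordinal x2)), 1; rewrite inE /ltl /lhd /= -surjective_pairing -E1 px pz /=.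
    by split=> // a; rewrite mul1r.
  - exists (false, (Ordinal x1, Ordinal x2)), 1; rewrite inE /ltl /lhd /= -surjective_pairing -E1 px pz /=.
    by split=> // a; rewrite mul1r.
  - exists (true, (Ordinal z1, Ordinal z2)), (-1); rewrite inE /ltl /lhd /= -surjective_pairing -E1 px pz /=.
    by split=> // a; rewrite mulN1r opprB.
  - exists (false, (Ordinal z1, Ordinal z2)), (-1); rewrite inE /ltl /lhd /= -surjective_pairing -E1 px pz /=.
    by split=> // a; rewrite mulN1r opprB.
exists (fun k => psi k + (k == e)%:R * c); split=> [k nk|a].
  rewrite psi0 // (_ : k == e = false) ?mul0r ?addr0 //.
  by apply: contraNF nk => /eqP->.
under eq_bigr do rewrite mulrDl; rewrite big_split /= psia.
rewrite [X in _ + X](bigD1 e) //= eqxx mul1r ce big1 => [|k /negbTE->]; last by rewrite !mul0r.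
by ring.
Qed.

(** Deletion merges faces, so the new faces are the components of [relF]. A lifted vertex potential
    does not change along contracted edges, nor a lifted face potential across deleted ones, so
    orthogonality descends. For exactness, circulations are lifted through the branch sets
    instead. *)
Lemma minor_dual : exists (F : finType) (lf rg : E -> F),
  orthogonal tl hd lf rg /\ face_exact tl hd lf rg.
Proof.
pose relF (f f' : I * I) := [exists e in deleted,
  ((f == llf e) && (f' == lrg e)) || ((f == lrg e) && (f' == llf e))].
have relF_sym : symmetric relF.
  by move=> f f'; apply: eq_existsb => e; rewrite orbC [X in _ && (X || _)]andbC [X in _ && (_ || X)]andbC.
have csym := sym_connect_sym relF_sym.
have del_relF e : e \in deleted -> relF (llf e) (lrg e).
  by move=> eD; apply/exists_inP; exists e; rewrite // !eqxx.
exists (I * I)%type, (fun e => fingraph.root relF (llf (iota e))), (fun e => fingraph.root relF (lrg (iota e))).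
split=> [a b|phi cons].
  pose a0 i j := if p (i, j) is Some v then a v else 0.
  have a0i : interior a0.
    move=> i j ij; rewrite /a0; case pE: (p (i, j)) => [v|//].
    have := p_interior pE; rewrite /=; move: ij.
    by case/or4P => /eqP->; rewrite ?ltnn ?andbF //=.
  rewrite -[RHS](lattice_orthogonal (fun f => b (fingraph.root relF f)) a0i).
  rewrite [RHS](bigID [in kept]) /= [X in _ + X]big1 => [|e nk]; last first.
    have [eC|eC] := boolP (e \in contracted).
      move: eC; rewrite inE /a0 -!surjective_pairing => /andP[_ /eqP->].
      by rewrite subrr mul0r.
    have /del_relF/connect1/(fingraph.rootP csym)-> : e \in deleted by rewrite in_setC in_setU negb_or nk eC.
    by rewrite subrr mulr0.
  rewrite addr0 /kept big_imset /=; last by move=> ? ? _ _; apply: iota_inj.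
  rewrite [RHS](eq_bigl xpredT) => [|e]; last by rewrite inE.
  apply: eq_bigr => e _; by rewrite /a0 -!surjective_pairing iota_tl iota_hd.
pose r v : latpoint := if [pick y : I * I | p (val y.1, val y.2) == Some v] is Some y
  then (val y.1, val y.2) else (0, 0)%N.
have rP x v : p x = Some v -> p (r v) = Some v.
  move=> px; rewrite /r; case: pickP => [y /eqP //|none].
  have /andP[/andP[_ x1] /andP[_ x2]] := p_interior px.
  by have := none (Ordinal x1, Ordinal x2); rewrite /= -surjective_pairing px eqxx.
(* One unit goes from the representative of [tl e] through its branch set to [iota e], across it,
   and on to the representative of [hd e]. Fixed representatives make the lift of a circulation
   conserved in the lattice. *)
have [psi psiP] : exists psi : E -> ledge -> int, forall e,
    [/\ forall e', psi e (iota e') = (e' == e)%:R,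
        forall k, k \in deleted -> psi e k = 0 &
        forall a : latpoint -> int, \sum_k psi e k * (a (lhd k) - a (ltl k)) =
          a (r (hd e)) - a (r (tl e))].
  apply: (@fin_all_exists _ (fun=> ledge -> int) (fun e psi => [/\ forall e', psi (iota e') = (e' == e)%:R,
        forall k, k \in deleted -> psi k = 0 &
        forall a : latpoint -> int, \sum_k psi k * (a (lhd k) - a (ltl k)) =
          a (r (hd e)) - a (r (tl e))])) => e.
  have [psi1 [psi10 psi1a]] := route (rP _ _ (iota_tl e)) (iota_tl e).
  have [psi2 [psi20 psi2a]] := route (iota_hd e) (rP _ _ (iota_hd e)).
  exists (fun k => psi1 k + (k == iota e)%:R + psi2 k); split=> [e'|k|a].
  - by rewrite psi10 ?psi20 ?kept_not_contracted // add0r addr0 (inj_eq iota_inj).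
  - rewrite in_setC in_setU negb_or => /andP[kk kc]; rewrite psi10 ?psi20 //.
    rewrite add0r addr0 (_ : k == iota e = false) //.
    by apply: contraNF kk => /eqP->; apply: keptP.
  - under eq_bigr do rewrite !mulrDl; rewrite !big_split /= psi1a psi2a.
    rewrite [X in _ + X + _](bigD1 (iota e)) //= eqxx mul1r big1 => [|k /negbTE->]; last by rewrite mul0r.
    by ring.
pose Phi k := \sum_e phi e * psi e k.
have Phi_iota e : Phi (iota e) = phi e.
  rewrite /Phi (bigD1 e) //= (let: And3 P _ _ := psiP e in P) eqxx mulr1 big1 ?addr0 // => e' ne.
  by rewrite (let: And3 P _ _ := psiP e' in P) eq_sym (negbTE ne) mulr0.
have Phi_del k : k \in deleted -> Phi k = 0.
  by move=> kD; rewrite /Phi big1 // => e _; rewrite (let: And3 _ P _ := psiP e in P) ?mulr0.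
have [||g gE] := @lattice_exact Phi.
- move=> a _; rewrite /Phi.
  transitivity (\sum_e phi e * (\sum_k psi e k * (a (lhd k).1 (lhd k).2 - a (ltl k).1 (ltl k).2))).
    under eq_bigr do rewrite mulr_suml.
    rewrite exchange_big; apply: eq_bigr => e _; rewrite mulr_sumr.
    by apply: eq_bigr => k _; rewrite mulrA.
  rewrite -[RHS](cons (fun v => a (r v).1 (r v).2)); apply: eq_bigr => e _.
  by have [_ _ /(_ (fun x => a x.1 x.2)) ->] := psiP e.
- move=> k kb; apply: Phi_del; rewrite in_setC in_setU inE.
  have pN : p (ltl k) = None.
    case pE: (p (ltl k)) => [v|//]; have := p_interior pE.
    by case/orP: kb => /eqP->; rewrite ?ltnn ?andbF //=.
  rewrite pN /= orbF; apply/imsetP => -[e _ kE]; by rewrite kE iota_tl in pN.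
have gconst f f' : connect relF f f' -> g f = g f'.
  move=> c; elim/connect_rind: f' / c => // y z _ -> /exists_inP[e eD].
  have := gE e; rewrite (Phi_del e eD) => /esym/eqP; rewrite subr_eq0 => /eqP E1.
  by case/orP=> /andP[/eqP-> /eqP->]; rewrite E1.
exists g => e; rewrite -Phi_iota gE.
by rewrite (gconst _ _ (connect_root relF (llf _))) (gconst _ _ (connect_root relF (lrg _))).
Qed.
End Minor.
End Lattice.

(** * Lattice walks, and boxes in the maximum norm *)

Definition near_by (k : nat) (x y : latpoint) :=
  [&& x.1 <= y.1 + k, y.1 <= x.1 + k, x.2 <= y.2 + k & y.2 <= x.2 + k]%N.

Lemma near_by_sym k x y : near_by k x y = near_by k y x.
Proof. by rewrite /near_by; lia. Qed.

Lemma near_by_refl k x : near_by k x x.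
Proof. by rewrite /near_by !leq_addr. Qed.

Lemma near_by_trans k l x y z : near_by k x y -> near_by l y z -> near_by (k + l) x z.
Proof. rewrite /near_by; lia. Qed.

Lemma near_by_leq k l x y : (k <= l)%N -> near_by k x y -> near_by l x y.
Proof. rewrite /near_by; lia. Qed.

Lemma lattice_step_sym : symmetric lattice_step.
Proof.
by move=> x y; rewrite /lattice_step orbA orbC -!orbA.
Qed.

Lemma lattice_step_near x y : lattice_step x y -> near_by 1 x y.
Proof. by rewrite /near_by => /or4P[]/eqP->/=; lia. Qed.

Section Connected.
Variable P : pred latpoint.

Definition joined x y := exists q, [/\ path lattice_step x q, last x q = y & all P (x :: q)].

Lemma joined_refl x : P x -> joined x x.
Proof. by move=> Px; exists [::]; rewrite /= Px. Qed.

Lemma joined_trans x y z : joined x y -> joined y z -> joined x z.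
Proof.
move=> [q [xq <- Pq]] [r [yr <- /= /andP[_ Pr]]].
exists (q ++ r); rewrite cat_path xq yr last_cat; split=> //=.
by rewrite all_cat Pr andbT.
Qed.

Lemma joined_step x y : P x -> P y -> lattice_step x y -> joined x y.
Proof. by move=> Px Py xy; exists [:: y]; rewrite /= xy Px Py. Qed.

Lemma joined_sym x y : joined x y -> joined y x.
Proof.
move=> [q [xq <- Pq]]; elim: q x xq Pq => [|z q IH] x /=.
  by move=> _ /andP[Px _]; apply: joined_refl.
move=> /andP[xz zq] /and3P[Px Pz Pq].
apply: (@joined_trans _ z); first by apply: IH; rewrite //= Pz.
by apply: joined_step; rewrite // lattice_step_sym.
Qed.
End Connected.

Lemma joined_box (P : pred latpoint) m c x : (forall y, near_by m y c -> P y) ->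
  near_by m x c -> joined P x c.
Proof.
move=> boxP; have [n] := ubnP ((x.1 - c.1) + (c.1 - x.1) + ((x.2 - c.2) + (c.2 - x.2)))%N.
elim: n x => // n IH [x1 x2] /=; case: c boxP IH => c1 c2 boxP IH lt nx.
have go y : lattice_step (x1, x2) y -> near_by m y (c1, c2) ->
    ((y.1 - c1) + (c1 - y.1) + ((y.2 - c2) + (c2 - y.2)) <
      (x1 - c1) + (c1 - x1) + ((x2 - c2) + (c2 - x2)))%N -> joined P (x1, x2) (c1, c2).
  move=> xy ny lty; apply: (@joined_trans _ _ y).
    by apply: joined_step; rewrite // boxP.
  by apply: IH => //=; move: lt lty => /=; lia.
move: nx; rewrite /near_by /= => nx.
case: (ltngtP x1 c1) => h1.
- apply: (go (x1.+1, x2)); rewrite /lattice_step /near_by /= ?eqxx //; lia.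
- case: x1 h1 nx lt go => // x1 h1 nx lt go.
  apply: (go (x1, x2)); rewrite /lattice_step /near_by /= ?eqxx ?orbT //; lia.
- case: (ltngtP x2 c2) => h2.
  + apply: (go (x1, x2.+1)); rewrite /lattice_step /near_by /= ?eqxx ?orbT //; lia.
  + case: x2 h2 nx lt go => // x2 h2 nx lt go.
    apply: (go (x1, x2)); rewrite /lattice_step /near_by /= ?eqxx ?orbT //; lia.
  + rewrite h1 h2; apply: joined_refl; apply: boxP; rewrite /near_by /=; lia.
Qed.

Lemma joined_near (P : pred latpoint) x y : (forall z, near_by 1 z x -> P z) ->
  near_by 1 y x -> joined P x y.
Proof. by move=> Pb nyx; apply/joined_sym/(joined_box Pb). Qed.

(** Consecutive points may be diagonal neighbours, which no lattice edge joins; thickening the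
    sample by one supplies the corners. *)
Lemma walk_exists (f : nat -> latpoint) n : (forall k, (k < n)%N -> near_by 1 (f k) (f k.+1)) ->
  joined (fun x => [exists k : 'I_n.+1, near_by 1 x (f k)]) (f 0%N) (f n).
Proof.
elim: n => [|n IH] fk.
  apply: joined_refl; apply/existsP; exists ord0; exact: near_by_refl.
apply: (@joined_trans _ _ (f n)).
  have [q [pq lq aq]] := IH (fun k kn => fk k (ltnW kn)); exists q; split=> //.
  apply: sub_all aq => x /existsP[k xk]; apply/existsP.
  by exists (widen_ord (leqnSn _) k).
apply: joined_near; last by rewrite near_by_sym; apply: fk.
by move=> z zn; apply/existsP; exists (widen_ord (leqnSn _) ord_max).
Qed.

(** Start at the last visit to [P] and stop at the first visit to [Q] after it. *)
Lemma middle_part (P Q : pred latpoint) x q : path lattice_step x q -> P x -> Q (last x q) ->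
  (forall y, P y -> ~~ Q y) ->
  exists x0 r z, [/\ P x0, Q z, path lattice_step x0 (rcons r z),
    {subset r <= q} & {in r, forall y, ~~ P y && ~~ Q y}].
Proof.
move=> + + + PQ; have [n] := ubnP (size q); elim: n x q => // n IH x q ltn xq Px Qq.
have [/hasP[y yq Py]|/hasPn nP] := boolP (has P q).
  case/splitPr: yq xq Qq ltn => q1 q2; rewrite cat_path last_cat /= size_cat /=.
  move=> /and3P[_ _ yq2] Qq2 ltn.
  have [|x0 [r [z [Px0 Qz pr rq rPQ]]]] := IH y q2 _ yq2 Py Qq2; first lia.
  exists x0, r, z; split=> // u /rq uq; by rewrite mem_cat inE uq !orbT.
have hQ : has Q q.
  case: q {IH ltn} xq Qq nP => [|y q] /=; first by move=> _ /(contraL (PQ x)); rewrite Px.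
  by move=> _ Qq _; apply/(@hasP _ Q (y :: q)); exists (last y q) => //; exact: mem_last.
case: (split_find hQ) xq nP => z r s Qz nQ; rewrite cat_path => /andP[xr _] nP.
exists x, r, z; split=> //.
- by move=> u ur; rewrite mem_cat mem_rcons inE ur orbT.
- move=> u ur; rewrite nP ?mem_cat ?mem_rcons ?inE ?ur ?orbT //=.
  by apply: contra nQ => Qu; apply/hasP; exists u.
Qed.

(** * A lattice minor made of boxes and walks *)

Section Model.
Variables (M : nat) (V E : finType) (u v : E -> V) (c : V -> latpoint) (m : nat).
Variable W : E -> pred latpoint.
Notation N := M.+1.
Let box w x := near_by m x (c w).
Let inside (x : latpoint) := (0 < x.1 < N)%N && (0 < x.2 < N)%N.
Hypothesis neq_uv : forall e, u e != v e.
Hypothesis far : forall a b, a != b -> ~~ near_by (m + m).+1 (c a) (c b).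
Hypothesis walk : forall e, joined (W e) (c (u e)) (c (v e)).
Hypothesis avoid : forall e w x, W e x -> box w x -> w = u e \/ w = v e.
Hypothesis cross : forall e f x, W e x -> W f x -> e != f -> exists w, box w x.
Hypothesis box_inside : forall w x, box w x -> inside x.
Hypothesis walk_inside : forall e x, W e x -> inside x.

(** The extra one in [far] keeps distinct boxes from touching by a lattice step, so the middle of a
    walk is never empty. *)
Lemma box_disjoint a b x y : box a x -> box b y -> near_by 1 x y -> a = b.
Proof.
move=> ax byy xy; apply/eqP; apply: contraT => /far /negP[].
move: ax byy xy; rewrite /box /near_by; lia.
Qed.

Lemma box_unique a b x : box a x -> box b x -> a = b.
Proof. by move=> ax bx; apply: (box_disjoint ax bx); apply: near_by_refl. Qed.

Lemma walk_middle e : exists t : latpoint * seq latpoint * latpoint,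
  [/\ box (u e) t.1.1, box (v e) t.2, path lattice_step t.1.1 (rcons t.1.2 t.2),
    {in t.1.2, forall x, W e x} & {in t.1.2, forall x w, ~~ box w x}].
Proof.
have [q [xq lq /allP Wq]] := walk e.
have boxc w : box w (c w) by apply: near_by_refl.
have [||| x [r [z [xu zv xr rq nr]]]] := @middle_part (box (u e)) (box (v e)) _ q xq.
- exact: boxc.
- by rewrite lq.
- move=> y yu; apply/negP => yv; move: (neq_uv e); by rewrite (box_unique yu yv) eqxx.
have rW y : y \in r -> W e y by move=> /rq yq; apply: Wq; rewrite inE yq orbT.
exists (x, r, z); split=> // y yr w; apply/negP => wy.
have /andP[nu nv] := nr y yr.
by case: (avoid (rW y yr) wy) => E1; subst w; [case/negP: nu | case/negP: nv].
Qed.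

Lemma step_ledge x y : lattice_step x y -> inside x -> inside y ->
  exists e : ledge M, (ltl e = x /\ lhd e = y) \/ (ltl e = y /\ lhd e = x).
Proof.
case: x y => [x1 x2] [y1 y2] xy /andP[/= /andP[_ h1] /andP[_ h2]] /andP[/= /andP[_ h3] /andP[_ h4]].
case/or4P: xy => /eqP[E1 E2] /=; subst.
- by exists (true, (Ordinal h1, Ordinal h2)); left.
- by exists (false, (Ordinal h1, Ordinal h2)); left.
- by exists (true, (Ordinal h3, Ordinal h4)); right.
- by exists (false, (Ordinal h3, Ordinal h4)); right.
Qed.

(** The branch set of [w] is its box together with the middles of the walks starting at [w], and
    [iota e] is the step by which the walk of [e] enters the box of [v e]. This step may run against
    the lattice direction, hence the choice of [tl] and [hd]. *)
Lemma lattice_model : exists (p : latpoint -> option V) (iota : E -> ledge M) (tl hd : E -> V),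
  [/\ forall e, (tl e = u e /\ hd e = v e) \/ (tl e = v e /\ hd e = u e),
      forall x w, p x = Some w -> inside x,
      injective iota,
      forall e, p (ltl (iota e)) = Some (tl e) /\ p (lhd (iota e)) = Some (hd e) &
      forall w x y, p x = Some w -> p y = Some w ->
        exists q, [/\ path lattice_step x q, last x q = y & {in q, forall z, p z = Some w}]].
Proof.
have [t tP] := fin_all_exists walk_middle.
pose mid e := (t e).1.2.
(* Both choices are unique: boxes are disjoint, and the middles of two walks could meet only inside
   a box. *)
pose p x := if [pick w | box w x] is Some w then Some w else
  if [pick e | x \in mid e] is Some e then Some (u e) else None.
have midW e x : x \in mid e -> W e x by have [_ _ _ h _] := tP e; apply: h.
have midB e x w : x \in mid e -> ~~ box w x by have [_ _ _ _ h] := tP e => xe; apply: h.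
have pbox w x : box w x -> p x = Some w.
  move=> wx; rewrite /p; case: pickP => [w' w'x|/(_ w)]; last by rewrite wx.
  by rewrite (box_unique wx w'x).
have pmid e x : x \in mid e -> p x = Some (u e).
  move=> xe; rewrite /p; case: pickP => [w wx|_]; first by have := midB e x w xe; rewrite wx.
  case: pickP => [f xf|/(_ e)]; last by rewrite xe.
  congr (Some (u _)); apply/eqP; apply: contraT => fe.
  have [w wx] := cross (midW _ _ xf) (midW _ _ xe) fe.
  by have := midB e x w xe; rewrite wx.
have pP x w : p x = Some w -> box w x \/ exists2 e, x \in mid e & w = u e.
  rewrite /p; case: pickP => [w' w'x [<-]|_]; first by left.
  by case: pickP => // e xe [<-]; right; exists e.
pose y0 e := last (t e).1.1 (mid e).
have yP e : [/\ y0 e \in mid e, box (v e) (t e).2 & lattice_step (y0 e) (t e).2].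
  have [xu zv + _ _] := tP e; rewrite rcons_path => /andP[_ st]; split=> //.
  have := mem_last (t e).1.1 (mid e); rewrite -/(y0 e) inE => /orP[/eqP y0E|//].
  exfalso; move: (neq_uv e); rewrite (@box_disjoint (u e) (v e) (y0 e) (t e).2) ?eqxx //.
    by rewrite y0E.
  exact: lattice_step_near.
have p_inside x w : p x = Some w -> inside x.
  by case/pP => [/box_inside//|[e /midW/walk_inside]].
have [iota iotaP] : exists iota : E -> ledge M, forall e,
    (ltl (iota e) = y0 e /\ lhd (iota e) = (t e).2) \/
    (ltl (iota e) = (t e).2 /\ lhd (iota e) = y0 e).
  apply: (@fin_all_exists _ (fun=> ledge M) (fun e i =>
    (ltl i = y0 e /\ lhd i = (t e).2) \/ (ltl i = (t e).2 /\ lhd i = y0 e))) => e.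
  have [ye ze st] := yP e; apply: step_ledge st _ _.
    exact: p_inside (pmid e _ ye).
  exact: p_inside (pbox _ _ ze).
pose tl e := odflt (u e) (p (ltl (iota e))).
pose hd e := odflt (u e) (p (lhd (iota e))).
have ends e : (p (ltl (iota e)) = Some (u e) /\ p (lhd (iota e)) = Some (v e)) \/
    (p (ltl (iota e)) = Some (v e) /\ p (lhd (iota e)) = Some (u e)).
  have [ye ze _] := yP e.
  by case: (iotaP e) => -[-> ->]; rewrite (pmid e _ ye) (pbox _ _ ze); auto.
exists p, iota, tl, hd; split=> //.
- by move=> e; rewrite /tl /hd; case: (ends e) => -[-> ->] /=; auto.
- move=> e f ef.
  have [ye ze _] := yP e; have [yf zf _] := yP f.
  have yef : y0 e = y0 f.
    case: (iotaP e) (iotaP f); rewrite ef => -[-> ->] [] [] // E1 E2.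
      by have := midB e _ (v f) ye; rewrite E1 zf.
    by have := midB e _ (v f) ye; rewrite E2 zf.
  apply/eqP; apply: contraT => nef.
  have [w wy] := cross (midW _ _ ye) (midW _ _ (eq_ind_r (fun y => y \in mid f) yf yef)) nef.
  by have := midB e _ w ye; rewrite wy.
- by move=> e; rewrite /tl /hd; case: (ends e) => -[-> ->].
suff conn w x : p x = Some w -> joined (fun x => p x == Some w) x (c w).
  move=> w x y px py; have [q [xq lq /= /andP[_ /allP pq]]] := joined_trans (conn w x px) (joined_sym (conn w y py)).
  by exists q; split=> // z zq; apply/eqP/pq.
have cbox w' x' : box w' x' -> joined (fun x => p x == Some w') x' (c w').
  by apply: joined_box => z /pbox->.
case/pP => [|[e xe ->]]; first exact: cbox.
have [xu _ + _ _] := tP e; rewrite -/(mid e) rcons_path => /andP[pe _].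
have [a [b midE]] : exists a b, mid e = a ++ x :: b.
  by case/splitPr: (mid e) / xe => a b; exists a, b.
move: pe; rewrite midE cat_path /= => /and3P[pa st _].
apply: (@joined_trans _ _ (t e).1.1); last exact: cbox.
apply: joined_sym; exists (rcons a x); rewrite rcons_path pa st last_rcons; split=> //.
apply/allP => z; rewrite inE mem_rcons inE => /or3P[/eqP->|/eqP->|za]; apply/eqP.
- exact: pbox.
- by apply: pmid; rewrite midE mem_cat inE eqxx orbT.
- by apply: pmid; rewrite midE mem_cat za.
Qed.
End Model.

(** * Discretizing a planar drawing *)

From mathcomp Require Import all_classical all_reals all_analysis.
Import numFieldNormedType.Exports.
Local Open Scope classical_set_scope.

Section Plane.
Variable R : realType.
Implicit Types A B : set (R * R).

Lemma compact_separated A B : compact A -> compact B -> A `&` B = set0 ->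
  exists2 r : R, 0 < r & forall a b, A a -> B b -> r <= `|a - b|.
Proof.
move=> cA cB AB0.
have [[a0 Aa0]|A0] := pselect (A !=set0); last first.
  by exists 1 => // a b Aa; case: A0; exists a.
have [[b0 Bb0]|B0] := pselect (B !=set0); last first.
  by exists 1 => // a b _ Bb; case: B0; exists b.
have cf : continuous (fun x : (R * R) * (R * R) => `|x.1 - x.2| : R).
  by move=> x; apply: cvg_norm; apply: cvgB; [exact: cvg_fst|exact: cvg_snd].
have AB : A `*` B !=set0 by exists (a0, b0).
have [[a b]] := compact_EVT_min AB (compact_setX cA cB) (continuous_subspaceT cf).
rewrite inE => -[/= Aa Bb] min; exists `|a - b|.
- rewrite normr_gt0 subr_eq0; apply/eqP => ab.
  have : (A `&` B) a by split=> //; rewrite ab.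
  by rewrite AB0.
- by move=> a' b' Aa' Bb'; apply: (min (a', b')); rewrite inE.
Qed.

Lemma within_uniform (f : R -> R * R) : {within `[0, 1], continuous f} ->
  forall e : R, 0 < e -> exists2 d : R, 0 < d &
    forall s t, s \in `[0, 1]%R -> t \in `[0, 1]%R -> `|s - t| < d -> `|f s - f t| < e.
Proof.
move=> cf e e0.
have /compact_near_coveringP cov := @segment_compact R 0 1.
pose P (d x : R) := x \in `[0, 1]%R -> forall y, y \in `[0, 1]%R -> `|x - y| < d -> `|f x - f y| < e.
have := cov _ (0^'+) P _ _; case=> [x x01|d /= d0 dP].
  have /subspace_continuousP/(_ x x01) := cf.
  move=> /cvgrPdist_lt /(_ (e / 2)); rewrite divr_gt0 // => /(_ isT).
  move=> /nbhs_ballP[r /= r0 rP].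
  exists (ball x (r / 2), [set d | d < r / 2]).
    split; first by apply: nbhsx_ballx; rewrite divr_gt0.
    by apply: nbhs_right_lt; rewrite divr_gt0.
  case=> /= y d [xy dr] y01 z z01 yz.
  move: xy; rewrite -ball_normE /= => xy.
  have inr u : u \in `[0, 1]%R -> `|x - u| < r -> `|f x - f u| < e / 2.
    by move=> u01 xu; apply: rP => //; rewrite -ball_normE.
  rewrite (le_lt_trans (ler_distD (f x) _ _)) // [ltRHS](splitr e) ltrD //.
    by rewrite distrC inr // (lt_trans xy) // ltr_pdivrMr // ltr_pMr // ltr1n.
  rewrite inr // (le_lt_trans (ler_distD y _ _)) // [ltRHS](splitr r) ltrD //.
  exact: lt_trans dr.
exists (d / 2); first by rewrite divr_gt0.
move=> s t s01 t01 st; apply: (dP (d / 2)) => //=; last by rewrite divr_gt0.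
rewrite sub0r normrN gtr0_norm ?divr_gt0 // ltr_pdivrMr // ltr_pMr // ltr1n //.
Qed.

Lemma fin_uniform (I : finType) (Q : I -> R -> Prop) :
  (forall i r s, 0 < s -> s <= r -> Q i r -> Q i s) ->
  (forall i, exists2 r, 0 < r & Q i r) -> exists2 r, 0 < r & forall i, Q i r.
Proof.
move=> Qle /fin_all_exists2[r r0 Qr]; pose m := \big[Num.min/1]_i r i.
have m0 : 0 < m by apply/lt_bigmin.
by exists m => // i; apply: Qle (Qr i) => //; apply: bigmin_le_cond.
Qed.

Lemma norm_le_coord (x : R * R) r : (`|x| <= r) = (`|x.1| <= r) && (`|x.2| <= r).
Proof. by rewrite prod_normE ge_max. Qed.

Lemma closed_far (c : R * R) r : closed [set x : R * R | r <= `|x - c|].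
Proof.
have cf : continuous (fun x : R * R => `|x - c| : R).
  by move=> x; apply: cvg_norm; apply: cvgB; [exact: cvg_id|exact: cvg_cst].
exact: ((continuous_closedP _).1 cf _ (@closed_ge R r)).
Qed.

Section Cells.
Variables (K B : R) (s : nat).
Hypothesis K0 : 0 < K.

(** A grid of mesh [1 / K]. Adding [B] makes the coordinates of bounded points nonnegative before
    truncation; [s] keeps their cells away from the border of the lattice. *)
Definition cell (x : R * R) : latpoint :=
  (s + Num.truncn (K * (x.1 + B)), s + Num.truncn (K * (x.2 + B)))%N.

Lemma truncn_near (x y : R) k : 0 <= x -> 0 <= y -> x - y <= k%:R ->
  (Num.truncn x <= Num.truncn y + k)%N.
Proof.
move=> x0 y0 xy; rewrite -ltnS truncn_lt_nat //.
have /andP[_ yt] := truncn_itv y0.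
by move: yt xy; rewrite -addSn natrD; lra.
Qed.

Lemma near_truncn (x y : R) k : 0 <= x -> 0 <= y ->
  (Num.truncn x <= Num.truncn y + k)%N -> x - y <= k.+1%:R.
Proof.
move=> x0 y0; rewrite -(ler_nat R) natrD.
have /andP[_ xt] := truncn_itv x0; have /andP[yt _] := truncn_itv y0.
by move: xt yt; rewrite -[in X in _ < X -> _]addn1 -[in X in _ -> _ -> _ -> _ <= X]addn1 !natrD; lra.
Qed.

Definition bounded_by (x : R * R) := `|x| <= B.

Lemma bounded_coord x : bounded_by x -> 0 <= K * (x.1 + B) /\ 0 <= K * (x.2 + B).
Proof.
rewrite /bounded_by norm_le_coord => /andP[]; rewrite !ler_norml => /andP[h1 _] /andP[h2 _].
by split; apply: mulr_ge0; [exact: ltW|lra|exact: ltW|lra].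
Qed.

Lemma near_cell x y k : bounded_by x -> bounded_by y -> K * `|x - y| <= k%:R ->
  near_by k (cell x) (cell y).
Proof.
move=> /bounded_coord[x1 x2] /bounded_coord[y1 y2] xy.
have : `|x - y| <= `|x - y| by [].
rewrite norm_le_coord /= => /andP[]; rewrite !ler_norml.
move=> /andP[/(ler_wpM2l (ltW K0)) l1 /(ler_wpM2l (ltW K0)) u1].
move=> /andP[/(ler_wpM2l (ltW K0)) l2 /(ler_wpM2l (ltW K0)) u2].
rewrite mulrN in l1; rewrite mulrN in l2.
by rewrite /near_by /= -!addnA !leq_add2l; apply/and4P; split; apply: truncn_near => //;
  rewrite -mulrBr opprD addrACA subrr addr0; lra.
Qed.

(** Converse of [near_cell], up to one unit lost by truncation. *)
Lemma cell_near x y k : bounded_by x -> bounded_by y -> near_by k (cell x) (cell y) ->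
  K * `|x - y| <= k.+1%:R.
Proof.
move=> /bounded_coord[x1 x2] /bounded_coord[y1 y2].
rewrite /near_by /= -!addnA !leq_add2l => /and4P[].
move=> /(near_truncn x1 y1) h1 /(near_truncn y1 x1) h2 /(near_truncn x2 y2) h3 /(near_truncn y2 x2) h4.
rewrite -ler_pdivlMl // norm_le_coord /= !ler_norml -!mulrN.
by rewrite !ler_pdivlMl // !ler_pdivrMl //; apply/andP; split; apply/andP; split; lra.
Qed.

End Cells.
End Plane.

Lemma fin_upper (R : realType) (I : finType) (Q : I -> R -> Prop) :
  (forall i r s, r <= s -> Q i r -> Q i s) ->
  (forall i, exists r, Q i r) -> exists2 r, 0 < r & forall i, Q i r.
Proof.
move=> Qle /fin_all_exists[r Qr]; exists (\big[Num.max/1]_i r i).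
  by apply: lt_le_trans (bigmax_ge_id _ _ _ _); exact: ltr01.
by move=> i; apply: Qle (Qr i); apply: le_bigmax.
Qed.

Lemma joined_sub (P Q : pred latpoint) x y : {subset P <= Q} -> joined P x y -> joined Q x y.
Proof.
by move=> PQ [q [xq lq aq]]; exists q; split=> //; apply: sub_all aq.
Qed.

(** * Separation constants and the lattice model of a drawing *)

Section Drawing.
Variables (R : realType) (G : graph) (D : planar_drawing R G).
Notation V := (vertex G).
Notation E := (edge G).


Let unit_cases (t : R) : t \in `[0, 1]%R -> [\/ t = 0, t = 1 | t \in `]0, 1[%R].
Proof.
rewrite !in_itv /= => /andP[t0 t1].
move: t0; rewrite le_eqVlt => /orP[/eqP<-|t0]; first by constructor 1.
move: t1; rewrite le_eqVlt => /orP[/eqP->|t1]; first by constructor 2.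
by constructor 3; rewrite t0 t1.
Qed.

Lemma arc_endpoints : exists u v : E -> V, forall e,
  [/\ ends e = [set u e; v e]%SET, u e != v e, Defs.arc D e 0 = pos D (u e) &
      Defs.arc D e 1 = pos D (v e)].
Proof.
have [uv uvP] : exists uv : E -> V * V, forall e,
    [/\ ends e = [set (uv e).1; (uv e).2]%SET, Defs.arc D e 0 = pos D (uv e).1 & Defs.arc D e 1 = pos D (uv e).2].
  apply: (@fin_all_exists _ (fun=> (V * V)%type) (fun e uv =>
    [/\ ends e = [set uv.1; uv.2]%SET, Defs.arc D e 0 = pos D uv.1 & Defs.arc D e 1 = pos D uv.2])) => e.
  by have [u [v [? ? ?]]] := @arc_ends _ _ D e; exists (u, v).
exists (fun e => (uv e).1), (fun e => (uv e).2) => e; have [eE e0 e1] := uvP e.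
split=> //; have := card_ends e; rewrite eE cards2.
by case: (_ != _).
Qed.

Lemma compact_arc e : compact (Defs.arc D e @` `[0, 1]).
Proof. by apply: continuous_compact; [exact: arc_continuous|exact: segment_compact]. Qed.

Lemma drawing_separated : exists2 r : R, 0 < r &
  (forall a b, a != b -> r <= `|pos D a - pos D b|) /\
  (forall e w t, w \notin ends e -> t \in `[0, 1]%R -> r <= `|Defs.arc D e t - pos D w|).
Proof.
have [u [v uvP]] := arc_endpoints.
have [r1 r10 h1] : exists2 r : R, 0 < r & forall ab : V * V,
    ab.1 != ab.2 -> r <= `|pos D ab.1 - pos D ab.2|.
  apply: (@fin_uniform R (V * V)%type (fun ab r => ab.1 != ab.2 -> r <= `|pos D ab.1 - pos D ab.2|)).
    by move=> i r s _ sr h /h; apply: le_trans.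
  move=> [a b] /=; have [->|ab] := eqVneq a b; first by exists 1.
  exists `|pos D a - pos D b| => //; rewrite normr_gt0 subr_eq0.
  by apply: contra ab => /eqP /pos_inj ->.
have [r2 r20 h2] : exists2 r : R, 0 < r & forall ew : E * V,
    ew.2 \notin ends ew.1 -> forall t, t \in `[0, 1]%R -> r <= `|Defs.arc D ew.1 t - pos D ew.2|.
  apply: (@fin_uniform R (E * V)%type (fun ew r => ew.2 \notin ends ew.1 ->
     forall t, t \in `[0, 1]%R -> r <= `|Defs.arc D ew.1 t - pos D ew.2|)).
    by move=> i r s _ sr h wi t t01; apply: le_trans sr (h wi t t01).
  move=> [e w] /=; have [we|we] := boolP (w \in ends e); first by exists 1.
  have [|r r0 rP] := @compact_separated R _ [set pos D w] (@compact_arc e) (@compact_set1 _ _).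
    rewrite -subset0 => _ [[t t01 <-] /= tw].
    have [eE _ e0 e1] := uvP e; move: we; rewrite eE !inE negb_or => /andP[wu wv].
    case: (unit_cases t01) => [t0|t1|t01'].
    - by case/eqP: wu; apply: (pos_inj (p := D)); rewrite -e0 -t0.
    - by case/eqP: wv; apply: (pos_inj (p := D)); rewrite -e1 -t1.
    - exact: (arc_avoids_vertices t01' tw).
  by exists r => // _ t t01; apply: rP => //; exists t.
exists (Num.min r1 r2); first by rewrite lt_min r10.
split=> [a b ab|e w t we t01]; rewrite ge_min.
  by rewrite (h1 (a, b)).
by rewrite (h2 (e, w)) ?orbT.
Qed.

(** Arcs with a common end come arbitrarily close, so a bound exists only away from the vertices;
    there the rest of one arc is compact and disjoint from the other arc. *)
Lemma arcs_separated (r : R) : 0 < r -> exists2 eta : R, 0 < eta &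
  forall e f s t, e != f -> s \in `[0, 1]%R -> t \in `[0, 1]%R ->
    (forall w, r <= `|Defs.arc D e s - pos D w|) -> eta <= `|Defs.arc D e s - Defs.arc D f t|.
Proof.
move=> r0; have [u [v uvP]] := arc_endpoints.
pose Q (ef : E * E) eta := ef.1 != ef.2 -> forall s t, s \in `[0, 1]%R -> t \in `[0, 1]%R ->
    (forall w, r <= `|Defs.arc D ef.1 s - pos D w|) -> eta <= `|Defs.arc D ef.1 s - Defs.arc D ef.2 t|.
have [|| eta eta0 etaP] := @fin_uniform R (E * E)%type Q.
- by move=> i x y _ yx h ef s t s01 t01 far; apply: le_trans yx (h ef s t s01 t01 far).
- move=> [e f]; rewrite /Q /=; have [->|ef] := eqVneq e f; first by exists 1.
  pose A := (Defs.arc D e @` `[0, 1]) `&` \bigcap_(w in [set: V]) [set x | r <= `|x - pos D w|].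
  have cA : compact A.
    apply: compact_closedI; first exact: compact_arc.
    by apply: closed_bigI => w _; apply: closed_far.
  have [|eta eta0 etaP] := compact_separated cA (@compact_arc f); last first.
    exists eta => // _ s t s01 t01 far; apply: etaP; last by exists t.
    by split; [exists s|move=> w _; apply: far].
  rewrite -subset0 => _ [[[s s01 <-] far] [t t01 ts]].
  have far' w : Defs.arc D e s <> pos D w.
    by move=> E1; have := far w I; rewrite /= E1 subrr normr0 leNgt r0.
  have [_ _ e0 e1] := uvP e; have [_ _ f0 f1] := uvP f.
  case: (unit_cases s01) => [s0|s1|s01'].
  - by apply: (far' (u e)); rewrite s0 e0.
  - by apply: (far' (v e)); rewrite s1 e1.
  case: (unit_cases t01) => [t0|t1|t01'].
  - by apply: (far' (u f)); rewrite -ts t0 f0.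
  - by apply: (far' (v f)); rewrite -ts t1 f1.
  - exact: (arc_disjoint ef s01' t01' (esym ts)).
- by exists eta => // e f s t ef s01 t01 far; apply: (etaP (e, f)).
Qed.

Lemma drawing_bounded : exists2 B : R, 0 < B &
  (forall w, `|pos D w| <= B) /\ (forall e t, t \in `[0, 1]%R -> `|Defs.arc D e t| <= B).
Proof.
have [||B1 B10 h1] := @fin_upper R V (fun w r => `|pos D w| <= r).
- by move=> w r s rs h; apply: le_trans rs.
- by move=> w; exists `|pos D w|.
have [||B2 B20 h2] := @fin_upper R E (fun e r => forall t, t \in `[0, 1]%R -> `|Defs.arc D e t| <= r).
- by move=> e r s rs h t t01; apply: le_trans (h t t01) rs.
- move=> e; have [M [_ MP]] := compact_bounded (@compact_arc e).
  by exists (M + 1) => t t01; apply: MP; [rewrite ltrDl | exists t].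
exists (Num.max B1 B2); first by rewrite lt_max B10.
by split=> [w|e t t01]; rewrite le_max ?h1 // h2 ?orbT.
Qed.

Lemma sampling e (eps : R) : 0 < eps -> exists n, forall k, (k < n.+1)%N ->
  `|Defs.arc D e (k%:R / n.+1%:R) - Defs.arc D e (k.+1%:R / n.+1%:R)| <= eps.
Proof.
move=> eps0; have [d d0 dP] := within_uniform (@arc_continuous _ _ D e) eps0.
exists (Num.truncn d^-1) => k kn.
have n0 : (0 : R) < (Num.truncn d^-1).+1%:R by [].
have unit k' : (k' <= (Num.truncn d^-1).+1)%N -> (k'%:R / (Num.truncn d^-1).+1%:R : R) \in `[0, 1]%R.
  by move=> k'n; rewrite in_itv /= divr_ge0 //= ler_pdivrMr // mul1r ler_nat.
apply/ltW/dP; rewrite ?unit //; first exact: ltnW.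
rewrite -mulrBl -addn1 natrD opprD addrA subrr add0r mulN1r normrN.
by rewrite gtr0_norm ?invr_gt0 // invf_plt ?posrE // truncnS_gt.
Qed.

Lemma drawing_model : exists M (p : latpoint -> option V) (iota : E -> ledge M) (tl hd : E -> V),
  [/\ forall e, ends e = [set tl e; hd e]%SET /\ tl e != hd e,
      forall x w, p x = Some w -> (0 < x.1 < M.+1)%N && (0 < x.2 < M.+1)%N,
      injective iota,
      forall e, p (ltl (iota e)) = Some (tl e) /\ p (lhd (iota e)) = Some (hd e) &
      forall w x y, p x = Some w -> p y = Some w ->
        exists q, [/\ path lattice_step x q, last x q = y & {in q, forall z, p z = Some w}]].
Proof.
have [u [v uvP]] := arc_endpoints.
have [r r0 [rV rE]] := drawing_separated.
(* Half of [r / 4], the approximate radius of the boxes before scaling. *)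
have r80 : 0 < r / 8 by rewrite divr_gt0.
have [eta eta0 etaP] := arcs_separated r80.
have [B B0 [BV BE]] := drawing_bounded.
(* With boxes of radius m around the vertices, the scale K makes distinct boxes
   distant and keeps arcs leaving a common box in disjoint sets of cells. *)
have [K [K0 Kr Keta]] : exists K : R, [/\ 0 < K, 24 <= K * r & 4 <= K * eta].
  exists (24 / r + 4 / eta); rewrite addr_gt0 ?divr_gt0 //; split=> //.
    by rewrite mulrDl divfK ?gt_eqF // lerDl mulr_ge0 ?divr_ge0 ?ltW.
  by rewrite mulrDl [X in _ + X]divfK ?gt_eqF // lerDr mulr_ge0 ?divr_ge0 ?ltW.
(* Rounding [K * r / 4] down and subtracting one gives [2 * m + 2 < K * r], which separates boxes.
   From [24 <= K * r] follows [K * r / 8 <= m - 1], so a cell next to the cell of a point within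
   [r / 8] of a vertex still lies in its box. *)
have [m [m_lo m_hi]] : exists m, K * r / 4 < m.+2%:R /\ m.+1%:R <= K * r / 4.
  have T0 : 0 <= K * r / 4 by rewrite divr_ge0 // mulr_ge0 ?ltW.
  have /andP[lo hi] := truncn_itv T0.
  exists (Num.truncn (K * r / 4)).-1; rewrite prednK //.
  rewrite truncn_gt0 ler_pdivlMr // mul1r; apply: le_trans Kr.
  by rewrite ler_nat.
have m2 : (2 * m + 2)%:R < K * r.
  have -> : (2 * m + 2)%:R = 2 * m.+1%:R :> R by rewrite -natrM mulnS addnC.
  by move: m_hi Kr; lra.
have m1 : (0 < m)%N.
  rewrite lt0n; apply/eqP => E1; move: m_lo; rewrite E1; lra.
pose c x := cell K B m.+3 x.
have cK x y k : `|x| <= B -> `|y| <= B -> near_by k (c x) (c y) -> K * `|x - y| <= k.+1%:R.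
  exact: cell_near.
have Kc x y k : `|x| <= B -> `|y| <= B -> K * `|x - y| <= k%:R -> near_by k (c x) (c y).
  exact: near_cell.
pose W e : pred latpoint := fun x => `[< exists2 t, t \in `[0, 1]%R & near_by 1 x (c (Defs.arc D e t)) >].
pose M := (Num.truncn (K * (B + B)) + m + m + 10)%N.
have c_inside x : `|x| <= B -> (m + 3 <= (c x).1 <= M - m - 2)%N && (m + 3 <= (c x).2 <= M - m - 2)%N.
  move=> xB; have [x1 x2] := bounded_coord K0 xB.
  have le a : a <= B -> (Num.truncn (K * (a + B)) <= Num.truncn (K * (B + B)))%N.
    by move=> aB; apply: le_truncn; rewrite ler_wpM2l ?(ltW K0) // lerD2r.
  move: xB; rewrite norm_le_coord !ler_norml => /andP[/andP[_ /le h1] /andP[_ /le h2]].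
  by move: h1 h2; rewrite /c /cell /M /=; clear; lia.
have [|||||||p [iota [tl [hd [th p1 p2 p3 p4]]]]] :=
  @lattice_model M V E u v (fun w => c (pos D w)) m W.
- by move=> e; have [] := uvP e.
- move=> a b ab; apply/negP => /(cK _ _ _ (BV a) (BV b)).
  apply/negP; rewrite -ltNge; apply: (lt_le_trans _ (_ : K * r <= _)).
    by rewrite (_ : (m + m).+2 = 2 * m + 2)%N //; clear; lia.
  by rewrite ler_pM2l // rV.
- move=> e; have K10 : 0 < K^-1 by rewrite invr_gt0.
  have [n nP] := sampling e K10.
  have unit k : (k <= n.+1)%N -> (k%:R / n.+1%:R : R) \in `[0, 1]%R.
    by move=> kn; rewrite in_itv /= divr_ge0 //= ler_pdivrMr // mul1r ler_nat.
  have := @walk_exists (fun k => c (Defs.arc D e (k%:R / n.+1%:R))) n.+1.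
  rewrite mul0r divff ?pnatr_eq0 //; have [_ _ -> ->] := uvP e.
  move=> wk; apply: joined_sub (wk _).
    move=> x /existsP[k xk]; apply/asboolP; exists (k%:R / n.+1%:R) => //.
    by apply: unit; rewrite -ltnS.
  move=> k kn; apply: Kc; [apply: BE; apply: unit; exact: ltnW|by apply: BE; apply: unit|].
  by rewrite -ler_pdivlMl // mulr1 nP.
- move=> e w x /asboolP[t t01 xt] xw; have [eE _ _ _] := uvP e.
  have [we|we] := boolP (w \in ends e).
    by move: we; rewrite eE !inE => /orP[]/eqP->; auto.
  exfalso; have := near_by_trans (etrans (near_by_sym _ _ _) xt) xw.
  move=> /(cK _ _ _ (BE e t t01) (BV w)); apply/negP; rewrite -ltNge.
  apply: (lt_le_trans _ (_ : K * r <= _)); last by rewrite ler_pM2l // rE.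
  by apply: le_lt_trans m2; rewrite ler_nat; clear; lia.
- move=> e f x /asboolP[s s01 xs] /asboolP[t t01 xt] ef; apply: contrapT => nbox.
  have st := near_by_trans (etrans (near_by_sym _ _ _) xs) xt.
  have := cK _ _ _ (BE e s s01) (BE f t t01) st.
  (* Both points have cells next to [x], so their scaled distance is at most 3, less than [K * eta].
     Hence the point on [e] is closer than [r / 8] to a vertex. *)
  apply/negP; rewrite -ltNge; apply: (@lt_le_trans _ _ (K * eta)); first by lra.
  rewrite ler_pM2l //; apply: etaP => // w; rewrite leNgt; apply/negP => near.
  apply: nbox; exists w; apply: (@near_by_leq (1 + m.-1)); first by rewrite add1n prednK.
  apply: near_by_trans xs _; apply: Kc; [exact: BE|exact: BV|].
  apply: (@le_trans _ _ (K * (r / 8))); first by rewrite ler_pM2l // ltW.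
  have : m.+2%:R = m.-1%:R + 3 :> R by rewrite -natrD addn3 prednK.
  by lra.
- by move=> w x; rewrite /near_by; have := c_inside _ (BV w); move: (c _); rewrite /M; clear; lia.
- by move=> e x /asboolP[t t01]; rewrite /near_by; have := c_inside _ (BE e t t01); move: (c _); rewrite /M; clear; lia.
exists M, p, iota, tl, hd; split=> // e; have [eE nuv _ _] := uvP e.
by case: (th e) => -[-> ->]; rewrite eE; split=> //; [rewrite finset.setUC | rewrite eq_sym].
Qed.
End Drawing.

(** * Orders and drawings *)

Section HullTheory.
Variables (T : finType) (le : rel T).
Hypothesis lin : linear_order le.

Lemma linear_strict_total : strict_total [set: T]%SET (fun x y => (x != y) && le x y).
Proof.
have [rf an tr tt] := lin; split=> [x|y x z _ _ _ /andP[nxy xy] /andP[nyz yz]|x y _ _ nxy].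
- by rewrite eqxx.
- rewrite (tr _ _ _ xy yz) andbT; apply: contra nxy => /eqP xz; subst z.
  by rewrite (an x y) // xy.
- by rewrite nxy eq_sym nxy /=; apply: tt.
Qed.

Lemma hullP (X : {set T}) y :
  reflect (exists a b, [/\ a \in X, b \in X, le a y & le y b]) (y \in hull le X).
Proof.
have [rf an tr tt] := lin; rewrite inE; apply: (iffP existsP).
  case=> a /existsP[b /and4P[/andP[aX _] /andP[bX _] ay yb]].
  by exists a, b.
case=> a [b [aX bX ay yb]].
have X0 : X != finset.set0 by apply/set0Pn; exists a.
have XT : X \subset [set: T]%SET by apply/fintype.subsetP => z; rewrite inE.
have [m mX mmin] := strict_total_min linear_strict_total XT X0.
have [M MX Mmax] := strict_total_min (strict_total_rev linear_strict_total) XT X0.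
have mle x : x \in X -> le m x.
  by move=> xX; have [->//|/(mmin x xX)/andP[]] := eqVneq x m.
have leM x : x \in X -> le x M.
  by move=> xX; have [->//|/(Mmax x xX)/andP[]] := eqVneq x M.
exists m; apply/existsP; exists M; apply/and4P; split.
- by rewrite /is_min mX; apply/forall_inP.
- by rewrite /is_max MX; apply/forall_inP.
- exact: tr (mle a aX) ay.
- exact: tr yb (leM b bX).
Qed.
End HullTheory.

(** If [j] of class [v1] lies between [a] and [b] of class [v2], a member of class [v1] outside this
    range would make the classes cross. *)
Lemma noncrossing_hull (V T : finType) (lt : rel T) (key : T -> V) (v1 v2 : V) :
  let le x y := (x == y) || lt x y in
  linear_order le -> noncrossing [set: T]%SET lt key ->
  ([set e | key e == v1] :&: hull le [set e | key e == v2])%SET != finset.set0 ->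
  hull le [set e | key e == v1]%SET \subset hull le [set e | key e == v2]%SET.
Proof.
move=> le lin nc /set0Pn[j]; have [rf an tr tt] := lin.
rewrite finset.in_setI => /andP[]; rewrite finset.in_set => /eqP jv /(hullP lin)[a [b]].
rewrite !finset.in_set => -[/eqP av /eqP bv aj jb].
have inK v e : e \in [set e | key e == v]%SET -> key e = v by rewrite finset.in_set => /eqP.
suff inh j' : key j' = v1 -> j' \in hull le [set e | key e == v2]%SET.
  apply/fintype.subsetP => y /(hullP lin)[j1 [j2 [/inK/inh j1h /inK/inh j2h j1y yj2]]].
  have /(hullP lin)[a' [_ [a'X _ a'j _]]] := j1h.
  have /(hullP lin)[_ [b' [_ b'X _ jb']]] := j2h.
  by apply/(hullP lin); exists a', b'; split=> //; [exact: tr j1y|exact: tr jb'].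
move=> j'v; have [vv|nv] := eqVneq v1 v2.
  by apply/(hullP lin); exists j', j'; rewrite !inE j'v vv.
have strict x y : key x != key y -> le x y -> lt x y.
  by rewrite /le; have [->|_] := eqVneq x y; rewrite ?eqxx.
have {}aj : lt a j by apply: strict => //; rewrite av jv eq_sym.
have {}jb : lt j b by apply: strict => //; rewrite bv jv.
apply/(hullP lin); exists a, b; rewrite !inE av bv; split=> //.
- case/orP: (tt a j') => // /(strict j' a); rewrite av j'v => /(_ nv) ja.
  by case/eqP: nv; rewrite -j'v -av; apply: (nc j' a j b); rewrite ?inE // ?jv ?av.
- case/orP: (tt j' b) => // /(strict b j'); rewrite bv j'v eq_sym => /(_ nv) bj.
  by case/eqP: nv; rewrite -jv -av; apply/esym/(nc a j b j'); rewrite ?inE // ?av ?jv.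
Qed.

Lemma tail_neq_head (G : graph) (o : orientation G) e : tail_of o e != head_of o e.
Proof.
have := card_ends e; rewrite (tail_head_of o) cards2; by case: (_ != _).
Qed.

Lemma planar_order_upward (G : graph) (o : orientation G) (lt : rel (edge G)) :
  planar_order [set: edge G]%SET (tail_of o) (head_of o) lt ->
  @upward_planar_order (orient o) (fun e f => (e == f) || lt e f).
Proof.
case=> -[irr tr' tot'] up cons nch nct.
have tr : transitive lt by move=> y x z; apply: tr'; rewrite inE.
have tot x y : x != y -> lt x y || lt y x by apply: tot'; rewrite inE.
set le : rel (edge G) := fun e f => _.
have asym x y : lt x y -> lt y x -> False by move=> xy /(tr _ _ _ xy); rewrite irr.
have lin : linear_order le.
  split=> [x|x y|y x z|x y].
  - by rewrite /le eqxx.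
  - by move=> /andP[/orP[/eqP//|xy] /orP[/eqP//|yx]]; case: (asym x y).
  - move=> /orP[/eqP->//|xy] /orP[/eqP<-|yz]; first by rewrite /le xy orbT.
    by rewrite /le (tr _ _ _ xy yz) orbT.
  - rewrite /le; have [->//|nxy] := eqVneq x y; by case/orP: (tot _ _ nxy) => ->; rewrite ?orbT.
have [rf an trl tt] := lin.
have inT e : e \in [set: edge G]%SET by rewrite inE.
have inI v e : e \in @in_edges (orient o) v -> head_of o e = v by rewrite finset.in_set => /eqP.
have outO v e : e \in @out_edges (orient o) v -> tail_of o e = v by rewrite finset.in_set => /eqP.
have nle x y : ~~ lt x y -> le y x.
  by rewrite /le; case: eqVneq => //= nyx /negbTE nxy; have := tot _ _ nyx; rewrite nxy orbF.
have io i o' : head_of o i = tail_of o o' -> lt i o' by apply: up; rewrite inE.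
have lt_le x y : lt x y -> le x y by rewrite /le => ->; rewrite orbT.
split=> //.
- move=> e1 e2 /andP[ne /connectP[q]]; rewrite ne /=.
  elim: q e1 {ne} => [|f q IH] e1 /=; first by move=> _ ->; rewrite /le eqxx.
  move=> /andP[/eqP ef fq] E1; apply: trl (IH f fq E1).
  exact/lt_le/io.
- move=> v; split.
    apply/finset.setP => y; rewrite finset.in_setI finset.in_set0; apply/negP => /andP[].
    move=> /(hullP lin)[_ [i [_ iI _ yi]]] /(hullP lin)[p [_ [pO _ py _]]].
    have [iv pv] := (inI _ _ iI, outO _ _ pO).
    have ip : lt i p by apply: io; exact: (etrans iv (esym pv)).
    by case/orP: (trl _ _ _ py yi) => [/eqP E1|/(asym _ _ ip)//]; rewrite E1 irr in ip.
  apply/finset.setP => y; rewrite finset.in_setU; apply/idP/orP; last first.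
    by case=> /(hullP lin)[a [b [aX bX ay yb]]]; apply/(hullP lin); exists a, b;
      rewrite !finset.in_setU aX bX ?orbT.
  move=> /(hullP lin)[a [b [+ + ay yb]]]; rewrite !finset.in_setU.
  move=> /orP[aX|aX] /orP[bX|bX].
  + by left; apply/(hullP lin); exists a, b.
  + have [av bv] := (inI _ _ aX, outO _ _ bX).
    (* The consecutiveness clause gives an incoming edge above [y] or an outgoing edge below it;
       together with [a] or [b] it encloses [y] in one hull. *)
    have [[j [_ jv jy]]|[j [_ jv jy]]] := cons v a b y (inT a) (inT b) (inT y) av bv.
      left; apply/(hullP lin); exists a, j; split=> //; [rewrite inE; exact/eqP | exact: nle].
    right; apply/(hullP lin); exists j, b; split=> //; [rewrite inE; exact/eqP | exact: nle].
  + have [av bv] := (outO _ _ aX, inI _ _ bX).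
    have ba : lt b a by apply: io; exact: (etrans bv (esym av)).
    by case/orP: (trl _ _ _ ay yb) => [/eqP E1|/(asym _ _ ba)//]; rewrite E1 irr in ba.
  + by right; apply/(hullP lin); exists a, b.
- by move=> v1 v2; split; apply: (noncrossing_hull lin).
Qed.

Theorem drawing_orientable (R : realType) (G : graph) : planar_drawing R G ->
  exists (o : orientation G) (le : rel (edge G)), @upward_planar_order (orient o) le.
Proof.
move=> D; have [M [p [iota [tl [hd [endsE p_in iota_inj iotaP conn]]]]]] := drawing_model D.
have loopless e : tl e != hd e by have [] := endsE e.
have dual (A : {set edge G}) : has_dual tl hd A.
  apply: (@minor_dual M (vertex G) {e | e \in A} (tl \o val) (hd \o val) p (iota \o val)) => //.
  - by move=> e; apply: loopless.
  - by apply: inj_comp iota_inj val_inj.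
  - by move=> e; have [] := iotaP (val e).
  - by move=> e; have [] := iotaP (val e).
have [b [lt po]] : exists b lt,
    planar_order [set: edge G]%SET (flip b tl hd) (flip b hd tl) lt.
  have [e _|none] := pickP (xpredT : pred (edge G)).
    by have [b [lt [po _ _]]] := all_orientable loopless dual [set: edge G]%SET (tl e); exists b, lt.
  have noE (e : edge G) : False by have := none e.
  exists pred0, (fun _ _ => false); split; first split; try by move=> e; case: (noE e).
  by move=> v e; case: (noE e).
have th e : ends e = [set flip b tl hd e; flip b hd tl e]%SET.
  by rewrite /flip; have [-> _] := endsE e; case: (b e); rewrite // finset.setUC.
exists (Orientation th), (fun e f => (e == f) || lt e f).
exact: planar_order_upward.
Qed.

(** * Positions of vertices and edges on a line *)

Section Coordinates.
Variables (G : graph) (o : orientation G) (le : rel (edge G)).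
Hypothesis upo : @upward_planar_order (orient o) le.
Notation V := (vertex G).
Notation E := (edge G).
Notation tl := (tail_of o).
Notation hd := (head_of o).

Let lin : linear_order le. Proof. by case: upo. Qed.
Let lt x y := (x != y) && le x y.

Lemma order_rank : exists r : E -> nat, injective r /\ forall e f, le e f = (r e <= r f)%N.
Proof.
have [rf an tr tt] := lin; have [irr _ _] := linear_strict_total lin.
pose r e := #|[set f | lt f e]%SET|.
have mono e f : lt e f -> (r e < r f)%N.
  move=> /andP[nef ef]; apply: proper_card; apply/fintype.properP; split.
    apply/fintype.subsetP => x; rewrite !finset.in_set => /andP[nxe xe].
    rewrite /lt (tr _ _ _ xe ef) andbT; apply: contra nef => /eqP xf; subst x.
    by rewrite (an e f) // ef.
  by exists e; rewrite !finset.in_set /lt ?nef ?ef // eqxx.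
have le_r e f : le e f = (r e <= r f)%N.
  apply/idP/idP => [ef|].
    by have [->//|nef] := eqVneq e f; apply/ltnW/mono; rewrite /lt nef.
  apply: contraLR => nef; have fe : le f e by have := tt e f; rewrite (negbTE nef).
  rewrite -ltnNge; apply: mono; rewrite /lt fe andbT.
  by apply: contra nef => /eqP->; rewrite rf.
exists r; split=> // e f ef; apply: an; rewrite !le_r ef leqnn //.
Qed.

Lemma order_extremum (r : E -> nat) (P : pred E) : injective r ->
  (exists e, P e) -> exists m M, [/\ P m, P M, forall e, P e -> (r m <= r e)%N &
    forall e, P e -> (r e <= r M)%N].
Proof.
move=> r_inj [e0 Pe0]; case: (arg_minnP r Pe0) => m Pm mmin.
by case: (arg_maxnP r Pe0) => M PM Mmax; exists m, M.
Qed.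

Lemma in_before_out i e : hd i = tl e -> lt i e.
Proof.
have [_ up _ _] := upo; move=> ie; apply: up; rewrite /reaches; apply/andP; split.
  by apply/eqP => E1; subst e; have := tail_neq_head o i; rewrite -ie eqxx.
by apply: connect1; apply/eqP.
Qed.

(** By the second axiom such an [x] would lie in the hull of the incoming or of the outgoing edges,
    so below one of the former or above one of the latter. *)
Lemma no_edge_between v i e x : hd i = v -> tl e = v ->
  (forall i', hd i' = v -> lt i' x) -> (forall e', tl e' = v -> lt x e') -> False.
Proof.
have [rf an tr tt] := lin; have [_ _ /(_ v)[_ hullE] _] := upo; move=> iv ev ix xe.
have : x \in hull le (@inc_edges (orient o) v).
  have /andP[_ ix'] := ix i iv; have /andP[_ xe'] := xe e ev.
  apply/(hullP lin); exists i, e; split=> //; rewrite finset.in_setU !finset.in_set /=.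
    by rewrite iv eqxx.
  by rewrite ev eqxx orbT.
rewrite hullE finset.in_setU => /orP[] /(hullP lin)[a [b [+ + ax xb]]];
  rewrite !finset.in_set => /eqP av /eqP bv.
- by have /andP[/eqP nbx bx] := ix b bv; apply: nbx; apply: an; rewrite bx.
- by have /andP[/eqP nxa xa] := xe a av; apply: nxa; apply: an; rewrite xa.
Qed.

Lemma nested_in a f a' b : hd a = hd a' -> le a f -> le f a' -> hd b = hd f ->
  exists a1 a2, [/\ hd a1 = hd a, hd a2 = hd a, le a1 b & le b a2].
Proof.
have [rf an tr tt] := lin; have [_ _ _ /(_ (hd f) (hd a))[sub _]] := upo.
move=> aa' af fa' bf.
have /sub/fintype.subsetP/(_ b) : (@in_edges (orient o) (hd f) :&: hull le (@in_edges (orient o) (hd a)))%SET != finset.set0.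
  apply/set0Pn; exists f; rewrite finset.in_setI; apply/andP; split; first by rewrite finset.in_set.
  by apply/(hullP lin); exists a, a'; rewrite !finset.in_set /= aa'.
case/(_ _)/(hullP lin).
  by apply/(hullP lin); exists b, b; rewrite !finset.in_set /= bf.
by move=> a1 [a2 [+ + h1 h2]]; rewrite !finset.in_set => /eqP h3 /eqP h4; exists a1, a2.
Qed.

Lemma nested_out a f a' b : tl a = tl a' -> le a f -> le f a' -> tl b = tl f ->
  exists a1 a2, [/\ tl a1 = tl a, tl a2 = tl a, le a1 b & le b a2].
Proof.
have [rf an tr tt] := lin; have [_ _ _ /(_ (tl f) (tl a))[_ sub]] := upo.
move=> aa' af fa' bf.
have /sub/fintype.subsetP/(_ b) : (@out_edges (orient o) (tl f) :&: hull le (@out_edges (orient o) (tl a)))%SET != finset.set0.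
  apply/set0Pn; exists f; rewrite finset.in_setI; apply/andP; split; first by rewrite finset.in_set.
  by apply/(hullP lin); exists a, a'; rewrite !finset.in_set /= aa'.
case/(_ _)/(hullP lin).
  by apply/(hullP lin); exists b, b; rewrite !finset.in_set /= bf.
by move=> a1 [a2 [+ + h1 h2]]; rewrite !finset.in_set => /eqP h3 /eqP h4; exists a1, a2.
Qed.

(* A vertex sits on the line just after its last incoming edge, or just before
   its first outgoing edge when it has no incoming one; the residues modulo 4
   keep all positions distinct. *)
Lemma coordinates : exists (X : E -> nat) (x : V -> nat),
  [/\ injective X, injective x, forall e v, X e <> x v,
      forall e, (x (tl e) < X e < x (hd e))%N &
      forall e f, (X e < X f)%N ->
        ((X f < x (hd e))%N -> (x (hd f) <= x (hd e))%N) /\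
        ((x (tl f) < X e)%N -> (x (tl f) <= x (tl e))%N)].
Proof.
have [r [r_inj le_r]] := order_rank.
have [N rank_lt] : exists N, forall v : V, (enum_rank v < N)%N.
  by eexists => v; apply: ltn_ord.
(* Places below [N] are for isolated vertices; the successor of [r e] keeps even [X e - 1] above
   them. *)
pose X e := (N + 4 * (r e).+1)%N.
pose last_in v i := hd i = v /\ forall i', hd i' = v -> (r i' <= r i)%N.
pose first_out v e := tl e = v /\ forall e', tl e' = v -> (r e <= r e')%N.
pose spec v k := [\/ exists i e, [/\ last_in v i, first_out v e & k = X i + 2],
   exists2 i, last_in v i & (forall e, tl e <> v) /\ k = X i + 1,
   exists2 e, first_out v e & (forall i, hd i <> v) /\ k + 1 = X e |
   [/\ forall i, hd i <> v, forall e, tl e <> v & k = enum_rank v]]%N.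
have [x xP] : exists x : V -> nat, forall v, spec v (x v).
  apply: (@fin_all_exists _ (fun=> nat) spec) => v.
  have [/existsP hasI|noI] := boolP [exists i, hd i == v].
    have [_ [i [_ /eqP iv _ imax]]] := order_extremum r_inj hasI.
    have li : last_in v i by split=> // i' /eqP /imax.
    have [/existsP hasO|noO] := boolP [exists e, tl e == v].
      have [e [_ [/eqP ev _ emin _]]] := order_extremum r_inj hasO.
      by exists (X i + 2)%N; constructor 1; exists i, e; split=> //; split=> // e' /eqP /emin.
    exists (X i + 1)%N; constructor 2; exists i => //; split=> // e ev.
    by case/existsP: noO; exists e; apply/eqP.
  have noI' i : hd i <> v by move=> iv; case/existsP: noI; exists i; apply/eqP.
  have [/existsP hasO|noO] := boolP [exists e, tl e == v].
    have [e [_ [/eqP ev _ emin _]]] := order_extremum r_inj hasO.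
    exists (X e - 1)%N; constructor 3; exists e; first by split=> // e' /eqP /emin.
    by split=> //; rewrite /X; lia.
  exists (enum_rank v); constructor 4; split=> // e ev.
  by case/existsP: noO; exists e; apply/eqP.
have lt_r e f : lt e f -> (r e < r f)%N.
  move=> /andP[nef]; rewrite le_r leq_eqVlt => /orP[/eqP/r_inj E1|//].
  by rewrite E1 eqxx in nef.
have r_lt e f : (r e < r f)%N -> lt e f.
  move=> ef; rewrite /lt le_r ltnW // andbT; by apply: contraTneq ef => ->; rewrite ltnn.
have Xlt e f : (X e < X f)%N = (r e < r f)%N by rewrite /X; lia.
have hd_lt e : (X e < x (hd e))%N.
  case: (xP (hd e)) => [[i [e' [[_ /(_ e erefl) h] _ ->]]]|[i [_ /(_ e erefl) h] [_ ->]]|[e' _ [/(_ e)//]]|[/(_ e)//]];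
    by rewrite /X; lia.
have tl_lt e : (x (tl e) < X e)%N.
  case: (xP (tl e)) => [[i [e' [[iv _] _ ->]]]|[i _ [/(_ e)//]]|[e' [_ /(_ e erefl) h] [_]]|[_ /(_ e)//]].
    by have := lt_r _ _ (in_before_out iv); rewrite /X; lia.
  by rewrite /X; lia.
exists X, x; split.
- by move=> e f; rewrite /X => ef; apply: r_inj; lia.
- move=> u v uv; have := xP u; have := xP v; rewrite -uv.
  have X_inj e f : X e = X f -> e = f by rewrite /X => ef; apply: r_inj; lia.
  have ru := rank_lt u; have rv := rank_lt v.
  case=> [[i [e [[iv _] _ E1]]]|[i [iv _] [_ E1]]|[e [ev _] [_ E1]]|[_ _ E1]];
  case=> [[i' [e' [[iv' _] _ E2]]]|[i' [iv' _] [_ E2]]|[e' [ev' _] [_ E2]]|[_ _ E2]].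
  all: try (by exfalso; move: E1 E2 ru rv; rewrite /X; clear; lia).
  + by rewrite -iv -iv' (X_inj i i') //; move: E1 E2; clear; lia.
  + by rewrite -iv -iv' (X_inj i i') //; move: E1 E2; clear; lia.
  + by rewrite -ev -ev' (X_inj e e') //; move: E1 E2; clear; lia.
  + by apply/enum_rank_inj/val_inj; rewrite /= -E1 -E2.
- move=> f v E0; have := rank_lt v.
  by case: (xP v) => [[i [e [_ _]]]|[i _ [_]]|[e _ [_]]|[_ _]]; rewrite -E0 /X; clear; lia.
- by move=> e; rewrite hd_lt tl_lt.
- move=> e f ef; split=> [fe|fe].
    have [->//|nef] := eqVneq (hd f) (hd e).
    have [i [li ix]] : exists i, last_in (hd e) i /\ (x (hd e) = X i + 1 \/ x (hd e) = X i + 2)%N.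
      by case: (xP (hd e)) => [[i [e' [li _ E1]]]|[i li [_ E1]]|[e' _ [/(_ e)//]]|[/(_ e)//]];
        exists i; auto.
    have [j [lj jx]] : exists j, last_in (hd f) j /\ (x (hd f) = X j + 1 \/ x (hd f) = X j + 2)%N.
      by case: (xP (hd f)) => [[j [e' [lj _ E1]]]|[j lj [_ E1]]|[e' _ [/(_ f)//]]|[/(_ f)//]];
        exists j; auto.
    have [iv imax] := li; have [jv jmax] := lj.
    have fi : (r f <= r i)%N by move: fe ix; rewrite /X; clear; lia.
    (* The edge [f] lies between [e] and the last edge [i] entering [hd e], so the head class of [f]
       is nested in that of [e] and its last edge [j] precedes [i]. *)
    have [||a1 [a2 [_ a2v _ ja2]]] := @nested_in e f i j (esym iv) _ _ jv.
    - by rewrite le_r; move: ef; rewrite Xlt; apply: ltnW.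
    - by rewrite le_r.
    have : (r j < r i)%N.
      have := leq_trans (etrans (esym (le_r _ _)) ja2) (imax _ a2v).
      rewrite leq_eqVlt => /orP[/eqP/r_inj E1|//].
      by case/eqP: nef; rewrite -jv E1 iv.
    by move: ix jx; rewrite /X; clear; lia.
  have [->//|nef] := eqVneq (tl f) (tl e).
  have between v i m g : last_in v i -> first_out v m -> (r i < r g < r m)%N -> False.
    move=> [iv imax] [mv mmin] /andP[ig gm].
    apply: (@no_edge_between v i m g iv mv) => [i' /imax i'i|e' /mmin me'];
      apply: r_lt; [exact: leq_ltn_trans ig | exact: leq_trans me'].
  (* A vertex with incoming edges sits next to the last of these, but by [between] no edge separates
     it from its first outgoing edge [m]. So every edge to the right of the vertex is [m] or
     later. *)
  have [m [[mv mmin] mx mlo]] : exists m, [/\ first_out (tl f) m, (x (tl f) < X m)%N &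
      forall g, (x (tl f) < X g)%N -> (r m <= r g)%N].
    case: (xP (tl f)) => [[i [m [li fm E1]]]|[i _ [/(_ f)//]]|[m fm [_ E1]]|[_ /(_ f)//]].
      exists m; split=> // [|g].
        rewrite E1; have [iv _] := li; have [mv _] := fm.
        by have := lt_r _ _ (in_before_out (etrans iv (esym mv))); rewrite /X; clear; lia.
      move=> xg; rewrite leqNgt; apply/negP => gm; apply: (between _ _ _ g li fm).
      by rewrite gm andbT; move: xg; rewrite E1 /X; clear; lia.
    exists m; split=> // [|g]; first by rewrite -E1; clear; lia.
    by move: E1; rewrite /X; clear; lia.
  have me : (r m < r e)%N.
    have := mlo e fe; rewrite leq_eqVlt => /orP[/eqP/r_inj E1|//].
    by case/eqP: nef; rewrite -E1.
  have above m' : first_out (tl e) m' -> (r m < r m')%N.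
    move=> [m'v _].
    have [||a [_ [av _ am' _]]] := @nested_out m e f m' mv _ _ m'v.
    - by rewrite le_r ltnW.
    - by rewrite le_r; move: ef; rewrite Xlt; apply: ltnW.
    have : (r m <= r m')%N by apply: leq_trans (mmin a _) _; [rewrite av | rewrite -le_r].
    rewrite leq_eqVlt => /orP[/eqP/r_inj E1|//].
    by case/eqP: nef; rewrite -mv E1.
  case: (xP (tl e)) => [[i [m' [li fm' E1]]]|[i _ [/(_ e)//]]|[m' fm' [_ E1]]|[_ /(_ e)//]].
    rewrite E1; have mi : (r m <= r i)%N.
      by rewrite leqNgt; apply/negP => im; apply: (between _ _ _ m li fm'); rewrite im above.
    by move: mx mi; rewrite /X; clear; lia.
  by have := above _ fm'; move: mx E1; rewrite /X; clear; lia.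
Qed.
End Coordinates.

(** * Arcs made of two parabolas *)

Section Parabolas.
Variables (R : realType) (a c b : R).
Hypotheses (ac : a < c) (cb : c < b).

(** Minimum and maximum glue an arch below the line on [(a, c)] to one above it on [(c, b)], so
    continuity comes for free. The leading coefficients are 1 and -1 whatever the width, which makes
    nested arches comparable. *)
Definition wave (u : R) : R :=
  Num.min 0 ((u - c) * (u - a)) + Num.max 0 ((u - c) * (b - u)).

Lemma wave_left u : a <= u -> u <= c -> wave u = (u - c) * (u - a).
Proof.
move=> au uc; rewrite /wave min_r; last by rewrite mulr_le0_ge0 ?subr_le0 ?subr_ge0.
rewrite max_l ?addr0 // mulr_le0_ge0 ?subr_le0 ?subr_ge0 //.
exact: le_trans uc (ltW cb).
Qed.

Lemma wave_right u : c <= u -> u <= b -> wave u = (u - c) * (b - u).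
Proof.
move=> cu ub; rewrite /wave min_l; last first.
  by rewrite mulr_ge0 ?subr_ge0 //; apply: le_trans cu; apply: ltW.
by rewrite add0r max_r // mulr_ge0 ?subr_ge0.
Qed.

Lemma wave_lt0 u : a < u -> u < c -> wave u < 0.
Proof.
move=> au uc; rewrite wave_left ?ltW // nmulr_rlt0 ?subr_lt0 ?subr_gt0 //.
Qed.

Lemma wave_gt0 u : c < u -> u < b -> 0 < wave u.
Proof. by move=> cu ub; rewrite wave_right ?ltW // mulr_gt0 ?subr_gt0. Qed.

Lemma wave_continuous : continuous wave.
Proof.
move=> u; have lin (k : R) : {for u, continuous (fun x : R => x - k : R^o)}.
  by apply: cvgB; [exact: cvg_id|exact: cvg_cst].
have lin' : {for u, continuous (fun x : R => b - x : R^o)}.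
  by apply: cvgB; [exact: cvg_cst|exact: cvg_id].
have z : {for u, continuous (fun _ : R => 0 : R^o)} by apply: cvg_cst.
have h1 := continuous_min z (cvgM (lin c) (lin a)).
have h2 := continuous_max z (cvgM (lin c) lin').
exact: (cvgD (h1 _) (h2 _)).
Qed.
End Parabolas.

(** An edge is drawn as the graph of its wave, so two arcs can meet only over the same abscissa. By
    the signs, both points must then lie on arches on the same side of the line. There the arches
    are nested, and their difference is a positive product plus a nonnegative one. *)
Lemma upward_order_drawing (R : realType) (G : graph) (o : orientation G) (le : rel (edge G)) :
  @upward_planar_order (orient o) le -> inhabited (planar_drawing R G).
Proof.
move=> upo.
have [X [x [X_inj x_inj Xx mid nest]]] := coordinates upo.
pose a e : R := (x (tail_of o e))%:R; pose b e : R := (x (head_of o e))%:R.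
pose c e : R := (X e)%:R.
have ac e : a e < c e by rewrite ltr_nat; case/andP: (mid e).
have cb e : c e < b e by rewrite ltr_nat; case/andP: (mid e).
have ab e : 0 < b e - a e by rewrite subr_gt0 (lt_trans (ac e)).
pose s e (t : R) := a e + (b e - a e) * t.
have s_in e t : t \in `]0, 1[%R -> a e < s e t < b e.
  rewrite in_itv /= => /andP[t0 t1]; rewrite /s ltrDl mulr_gt0 //=.
  by rewrite -ltrBrDl gtr_pMr.
pose w e := wave (a e) (c e) (b e).
have w0 e u : a e < u < b e -> w e u = 0 -> u = c e.
  move=> /andP[au ub] wu; have [uc|cu|//] := ltgtP u (c e).
    by have := wave_lt0 (cb e) au uc; rewrite -/(w e u) wu ltxx.
  by have := wave_gt0 (ac e) cu ub; rewrite -/(w e u) wu ltxx.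
have disjoint e f u : c e < c f -> a e < u < b e -> a f < u < b f -> w e u <> w f u.
  move=> ef /andP[aeu ube] /andP[afu ubf] wE.
  have ef' : (X e < X f)%N by move: ef; rewrite ltr_nat.
  have [up dn] := nest e f ef'.
  have [ue|eu|ue] := ltgtP u (c e).
  - have afe : a f <= a e by rewrite ler_nat dn // -(ltr_nat R) (lt_trans afu).
    have uf := lt_trans ue ef; move: wE.
    rewrite /w (wave_left (cb e)) ?(wave_left (cb f)) ?ltW // => /eqP; apply/negP.
    rewrite -subr_eq0 lt0r_neq0 //.
    have -> : (u - c e) * (u - a e) - (u - c f) * (u - a f) =
      (c f - c e) * (u - a e) + (c f - u) * (a e - a f) by ring.
    by apply: ltr_pwDl; [apply: mulr_gt0; rewrite subr_gt0 | apply: mulr_ge0; rewrite subr_ge0 // ltW].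
  - have we := wave_gt0 (ac e) eu ube; have [uf|fu|uf] := ltgtP u (c f).
    + by have := wave_lt0 (cb f) afu uf; rewrite -/(w f u) -wE ltNge ltW.
    + have bfe : b f <= b e by rewrite ler_nat up // -(ltr_nat R) (lt_trans fu).
      move: wE; rewrite /w (wave_right (ac e)) ?(wave_right (ac f)) ?ltW // => /eqP; apply/negP.
      rewrite -subr_eq0 lt0r_neq0 //.
      have -> : (u - c e) * (b e - u) - (u - c f) * (b f - u) =
        (c f - c e) * (b e - u) + (u - c f) * (b e - b f) by ring.
      by apply: ltr_pwDl; [apply: mulr_gt0; rewrite subr_gt0 | apply: mulr_ge0; rewrite subr_ge0 // ltW].
    + move: we; rewrite -/(w e u) wE /w uf (wave_left (cb f)) ?lexx ?(ltW (ac f)) //.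
      by rewrite subrr mul0r ltxx.
  - have : w e u = 0 by rewrite /w ue (wave_left (cb e)) ?lexx ?(ltW (ac e)) // subrr mul0r.
    rewrite wE => /w0; rewrite afu ubf => /(_ isT) E1.
    by move: ef; rewrite -E1 ue ltxx.
have s_inj e : injective (s e).
  by move=> t t' /addrI /(mulfI (lt0r_neq0 (ab e))).
have nat_inj (m n : nat) : m%:R = n%:R :> R -> m = n.
  by move=> /eqP; rewrite eqr_nat => /eqP.
constructor; apply: (@PlanarDrawing R G (fun v => ((x v)%:R, 0)) (fun e t => (s e t, w e (s e t)))).
- by move=> u v [/nat_inj/x_inj].
- move=> e; apply: continuous_subspaceT => t.
  have st : {for t, continuous (s e)}.
    apply: cvgD; first exact: cvg_cst.
    by apply: cvgM; [exact: cvg_cst | exact: cvg_id].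
  have wt : {for t, continuous (w e \o s e)}.
    by apply: (continuous_comp st); apply: wave_continuous.
  exact: (@cvg_pair _ _ _ (nbhs t) (nbhs (s e t)) (nbhs (w e (s e t))) _ _ _ _ _ st wt).
- by move=> e t t' _ _ [/s_inj].
- move=> e; exists (tail_of o e), (head_of o e); split.
  + exact: tail_head_of.
  + rewrite /s mulr0 addr0 /w (wave_left (cb e)) ?lexx ?(ltW (ac e)) //.
    by rewrite subrr mulr0.
  + rewrite /s mulr1 addrC subrK /w (wave_right (ac e)) ?lexx ?(ltW (cb e)) //.
    by rewrite subrr mulr0.
- move=> e v t t01 [sv wv]; have := w0 e _ (s_in e t t01) wv.
  by rewrite sv => /nat_inj/esym/Xx.
- move=> e f t t' ef t01 t'01 [ss ww].
  have uf := s_in f t' t'01; rewrite -ss in ww uf.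
  have ue := s_in e t t01.
  have [ef'|fe'|/nat_inj/X_inj E1] := ltgtP (c e) (c f).
  + exact: (disjoint e f _ ef' ue uf).
  + exact: (disjoint f e _ fe' uf ue (esym ww)).
  + by rewrite E1 eqxx in ef.
Qed.

Theorem corollary6p5 (R : realType) (G : graph) :
  inhabited (planar_drawing R G) <->
  exists (o : orientation G) (le : rel (edge G)),
    @upward_planar_order (orient o) le.
Proof.
split=> [[D]|[dir [le upo]]]; first exact: drawing_orientable D.
exact: upward_order_drawing upo.
Qed.
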